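(* Let $\overline{K}$ be a closed $d$-symmetric set in $\mathbb{R}^{d+1}$ and let $s>0$. Assume that $\mathbf{B}^{d+1}\subseteq\overline{K}$. Consider the following condition (J): there are contact points $\overline{u}_1,\ldots,\overline{u}_k\in\mathrm{bd}(\mathbf{B}^{d+1})\cap\mathrm{bd}(\overline{K})$ and positive weights $c_1,\ldots,c_k$ such that $$\sum_{i=1}^k c_i\,\overline{u}_i\otimes\overline{u}_i=\overline{S}\quad\text{and}\quad\sum_{i=1}^k c_iu_i=0,$$ where $u_i$ is the orthogonal projection of $\overline{u}_i$ onto $\mathbb{R}^d$ and $\overline{S}=\mathrm{diag}(1,\ldots,1,s)\in\mathbb{R}^{(d+1)\times(d+1)}$. Then the following hold. (1) Assume that $\mathbf{B}^{d+1}$ is a locally maximal $s$-volume ellipsoid contained in $\overline{K}$, that is, in some neighborhood of $\mathbf{B}^{d+1}$ in the space of $d$-symmetric ellipsoids, no ellipsoid contained in $\overline{K}$ is of larger $s$-volume. Then (J) holds. Moreover, such contact points and positive weights exist for some $k$ with $d+1\le k\le\frac{(d+1)(d+2)}{2}+d+1$. (2) Assume that $\overline{K}={}^{(s)}\overline{f}$ for a proper log-concave function $f$ on $\mathbb{R}^d$, and that (J) holds. Then $\mathbf{B}^{d+1}$ is the unique ellipsoid of (globally) maximum $s$-volume among $d$-symmetric ellipsoids contained in $\overline{K}$.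
   Context: A function $f:\mathbb{R}^d\to[0,\infty)$ is log-concave if $f=e^{-\psi}$ for some convex $\psi:\mathbb{R}^d\to\mathbb{R}\cup\{\infty\}$; it is proper log-concave if moreover it is upper semi-continuous and has finite positive integral. Identify $\mathbb{R}^d$ with the hyperplane of $\mathbb{R}^{d+1}$ spanned by the first $d$ basis vectors; a set in $\mathbb{R}^{d+1}$ is $d$-symmetric if it is symmetric under reflection in $\mathbb{R}^d$. The $s$-lifting of $f$ is ${}^{(s)}\overline{f}=\{(x,\xi)\in\mathbb{R}^{d+1}: |\xi|\le f(x)^{1/s}\}$. The $s$-volume of a $d$-symmetric Borel set $\overline{C}\subset\mathbb{R}^{d+1}$ is ${}^{(s)}\mu(\overline{C})=\int_{\mathbb{R}^d}\left[\tfrac12\mathrm{length}(\overline{C}\cap\ell_x)\right]^s\,dx$, where $\ell_x$ is the line perpendicular to $\mathbb{R}^d$ at $x$. The $d$-symmetric ellipsoids are the sets $(A\oplus\alpha)\mathbf{B}^{d+1}+a$, each represented by a unique pair $(A\oplus\alpha,a)$ with $A\in\mathbb{R}^{d\times d}$ positive definite, $\alpha>0$, $a\in\mathbb{R}^d$; here $A\oplus\alpha$ is the block-diagonal $(d+1)\times(d+1)$ matrix and $\mathbf{B}^{d+1}$ is the Euclidean unit ball. Neighborhoods in the space of $d$-symmetric ellipsoids refer to the topology of the pairs $(A\oplus\alpha,a)$ as a subset of the finite-dimensional space of pairs (symmetric $(d+1)\times(d+1)$ matrix, vector in $\mathbb{R}^d$). $u\otimes u$ denotes $uu^{\intercal}$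 and $\mathrm{bd}$ the topological boundary in $\mathbb{R}^{d+1}$. *)

(* Defs.v *)
From HB Require Import structures.
From mathcomp Require Import all_boot all_order all_algebra.
From mathcomp Require Import all_classical all_reals all_analysis.

Set Implicit Arguments.
Unset Strict Implicit.
Unset Printing Implicit Defensive.

Import Order.TTheory GRing.Theory Num.Theory.
Import numFieldNormedType.Exports.

Local Open Scope classical_set_scope.
Local Open Scope ring_scope.

Section LebesgueMeasureRn.
Context {R : realType}.

Definition cons_pair n (p : measurableTypeR R * n.-tuple (measurableTypeR R)) :
  n.+1.-tuple (measurableTypeR R) := [the n.+1.-tuple _ of p.1 :: p.2].

Lemma measurable_cons_pair n : measurable_fun setT (@cons_pair n).
Proof. by apply: measurable_cons; [exact: measurable_fst|exact: measurable_snd]. Qed.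

Section push.
Variables (n : nat).
Variable mu : {sigma_finite_measure set (n.-tuple (measurableTypeR R)) -> \bar R}.

Definition push_cons : set (n.+1.-tuple (measurableTypeR R)) -> \bar R :=
  pushforward (lebesgue_measure \x mu)%E (@cons_pair n).

Let measurable_preimage_cons A : measurable A -> measurable (@cons_pair n @^-1` A).
Proof. by move=> mA; rewrite -[X in measurable X]setTI; exact: measurable_cons_pair. Qed.

Let push_cons0 : push_cons set0 = 0%E.
Proof. by rewrite /push_cons /pushforward preimage_set0 measure0. Qed.

Let push_cons_ge0 A : (0 <= push_cons A)%E.
Proof. by rewrite /push_cons /pushforward; exact: measure_ge0. Qed.

Let push_cons_sigma_additive : semi_sigma_additive push_cons.
Proof.
move=> F mF tF mUF; rewrite /push_cons /pushforward preimage_bigcup.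
apply: measure_semi_sigma_additive.
- by move=> k; exact: measurable_preimage_cons.
- apply/trivIsetP => /= i j _ _ ij; rewrite -preimage_setI.
  by move/trivIsetP : tF => /(_ _ _ _ _ ij) ->//; rewrite preimage_set0.
- by rewrite -preimage_bigcup; exact: measurable_preimage_cons.
Qed.

HB.instance Definition _ := isMeasure.Build _ _ _ push_cons
  push_cons0 push_cons_ge0 push_cons_sigma_additive.

Let push_cons_sigma_finite : sigma_finite setT push_cons.
Proof.
have /sigma_finiteP[F [TF ndF Foo]] :=
  sigma_finiteT (@lebesgue_measure R : {sigma_finite_measure set _ -> \bar R}).
have /sigma_finiteP[G [TG ndG Goo]] := sigma_finiteT mu.
pose g (t : n.+1.-tuple (measurableTypeR R)) := (thead t, [tuple of behead t]).
have mg : measurable_fun setT g.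
  apply/measurable_fun_pair => /=; [exact: measurable_tnth|exact: measurable_behead].
have gK p : g (cons_pair p) = p.
  by case: p => x t; congr pair; apply/val_inj.
exists (fun k => g @^-1` (F k `*` G k)).
  rewrite -preimage_bigcup (_ : \bigcup_i _ = setT) ?preimage_setT//.
  rewrite -setXTT TF TG predeqE => -[x y]; split.
    by move=> [k _ []/= ? ?]; split; exists k.
  move=> [/= [k _ Fkx] [l _ Gly]]; exists (maxn k l) => //; split.
  - by move: x Fkx; exact/subsetPset/ndF/leq_maxl.
  - by move: y Gly; exact/subsetPset/ndG/leq_maxr.
move=> k; have [mF Fk] := Foo k; have [mG Gk] := Goo k; split.
  by rewrite -[X in measurable X]setTI; apply: mg => //; exact: measurableX.
rewrite /push_cons /pushforward -comp_preimage.
rewrite (_ : g \o _ = id) ?preimage_id; last by apply/funext => p; exact: gK.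
by rewrite product_measure1E// lte_mul_pinfty// ge0_fin_numE.
Qed.

HB.instance Definition _ :=
  Measure_isSigmaFinite.Build _ _ _ push_cons push_cons_sigma_finite.

End push.

(* Lebesgue measure on R^n, as the n-fold product of the Lebesgue measure. *)
Fixpoint lebesgue_tuple n :
    {sigma_finite_measure set (n.-tuple (measurableTypeR R)) -> \bar R} :=
  match n with
  | 0 => dirac ([tuple] : 0.-tuple (measurableTypeR R))
  | n.+1 => push_cons (lebesgue_tuple n)
  end.
End LebesgueMeasureRn.

Section LiftedEllipsoids.
Context {R : realType}.

(* R^d is 'cV_d, R^(d+1) is 'cV_(d + 1), and (x, xi) is [lift_pt x xi]. *)
Definition lift_pt d (x : 'cV[R]_d) (xi : R) : 'cV[R]_(d + 1) := col_mx x xi%:M.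

(* Lebesgue integral over R^d; for [f] nonnegative and possibly infinite. *)
Definition Rn_integral d (f : 'cV[R]_d -> \bar R) : \bar R :=
  (\int[lebesgue_tuple d]_t f (\col_i tnth t i))%E.

Definition log_concave d (f : 'cV[R]_d -> R) : Prop :=
  exists psi : 'cV[R]_d -> \bar R,
    [/\ forall x, psi x != -oo%E,
        forall (x y : 'cV[R]_d) (t : R), 0 <= t <= 1 ->
          (psi (t *: x + (1 - t) *: y)%R
             <= t%:E * psi x + (1 - t)%:E * psi y)%E
      & forall x, (f x)%:E = expeR (- psi x)].

Definition upper_semicontinuous d (f : 'cV[R]_d -> R) : Prop :=
  lower_semicontinuous (fun x => (- f x)%:E).

Definition proper_log_concave d (f : 'cV[R]_d -> R) : Prop :=
  [/\ log_concave f, upper_semicontinuous f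
    & (0 < Rn_integral (fun x => (f x)%:E) < +oo)%E].

Definition d_symmetric d (C : set 'cV[R]_(d + 1)) : Prop :=
  forall x xi, C (lift_pt x xi) -> C (lift_pt x (- xi)).

Definition s_lifting d (s : R) (f : 'cV[R]_d -> R) : set 'cV[R]_(d + 1) :=
  [set z | exists x xi, z = lift_pt x xi /\ `|xi| <= f x `^ s^-1].

Definition s_volume d (s : R) (C : set 'cV[R]_(d + 1)) : \bar R :=
  Rn_integral (fun x =>
    ((2^-1)%R%:E * lebesgue_measure [set xi : R | C (lift_pt x xi)]) `^ s)%E.

Definition euclidean_ball n : set 'cV[R]_n :=
  [set v | \sum_i v i 0 ^+ 2 <= 1].
Arguments euclidean_ball : clear implicits.

Definition posdef n (A : 'M[R]_n) : Prop :=
  A^T = A /\ forall x : 'cV[R]_n, x != 0 -> 0 < (x^T *m A *m x) 0 0.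

(* [p] is a pair (A (+) alpha, a) representing a d-symmetric ellipsoid *)
Definition ellipsoid_pair d (p : 'M[R]_(d + 1) * 'cV[R]_d) : Prop :=
  exists (A : 'M[R]_d) (alpha : R),
    [/\ posdef A, 0 < alpha & p.1 = block_mx A 0 0 alpha%:M].

Definition ellipsoid d (p : 'M[R]_(d + 1) * 'cV[R]_d) : set 'cV[R]_(d + 1) :=
  [set p.1 *m v + lift_pt p.2 0 | v in euclidean_ball (d + 1)].

Definition locally_max_ball d (s : R) (K : set 'cV[R]_(d + 1)) : Prop :=
  euclidean_ball (d + 1) `<=` K /\
  \forall p \near ((1%:M : 'M[R]_(d + 1)), (0 : 'cV[R]_d)),
    ellipsoid_pair p -> ellipsoid p `<=` K ->
    (s_volume s (ellipsoid p) <= s_volume s (euclidean_ball (d + 1)))%E.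

Definition max_ellipsoid d (s : R) (K E : set 'cV[R]_(d + 1)) : Prop :=
  [/\ exists2 p, ellipsoid_pair p & E = ellipsoid p,
      E `<=` K
    & forall p, ellipsoid_pair p -> ellipsoid p `<=` K ->
        (s_volume s (ellipsoid p) <= s_volume s E)%E].

Definition bd n (C : set 'cV[R]_n) : set 'cV[R]_n := closure C `\` interior C.

(* Condition (J) with exactly [k] contact points. *)
Definition john_condition d (s : R) (K : set 'cV[R]_(d + 1)) (k : nat) : Prop :=
  exists (u : 'I_k -> 'cV[R]_(d + 1)) (c : 'I_k -> R),
    [/\ forall i, (bd (euclidean_ball (d + 1)) `&` bd K) (u i),
        forall i, 0 < c i,
        \sum_i c i *: (u i *m (u i)^T) = block_mx 1%:M 0 0 s%:M
      & \sum_i c i *: usubmx (u i) = 0].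

End LiftedEllipsoids.
Arguments euclidean_ball {R} n _.

(* Main.v *)
Require Import Defs.
From HB Require Import structures.
From mathcomp Require Import all_boot all_order all_algebra.
From mathcomp Require Import all_classical all_reals all_analysis.
From mathcomp Require Import zify ring lra.
From mathcomp Require Import measurable_realfun.
Import Order.TTheory GRing.Theory Num.Theory.
Import numFieldNormedType.Exports.
Local Open Scope classical_set_scope.
Local Open Scope ring_scope.

(** The s-volume of the ellipsoid (A (+) alpha, a) is det A * alpha^s times that
    of the ball. If (J) fails then S / tr S, paired with 0, lies outside the convex
    hull of the compact set of pairs (u u^T, u), which Caratheodory's theorem
    controls, and a strictly separating functional yields a direction (H (+) eta, h)
    with tr H + s eta > 0 along which the ball, moved a little, stays inside K
    while its s-volume grows. Conversely, log-concavity turns each contact point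
    (x, xi) into a tangent inequality x.y + xi^2 (1 + ln (eta / |xi|)) <= 1 for all
    (y, eta) in K with eta > 0; applied to the images of the contact points in an
    inscribed ellipsoid and summed with the weights c_i it gives
    tr A - d + s ln alpha <= 0, while ln det A <= tr A - d with equality only at
    A = 1. *)

(** * Positive definite matrices *)

Section PositiveDefinite.
Context {R : realType}.

(** Schur complements replace diagonalisation. A positive definite matrix is a positive pivot
    bordering a smaller positive definite matrix, and this one recursion yields ln det A <= tr A -
    d, its equality case and the linear change of variables. The last fits the iterated product form
    of the measure: triangular factors are integrated one coordinate at a time by Tonelli. The upper
    bound on k is one more than the dimension (d+1)(d+2)/2 + d of the space of pairs (symmetric
    matrix, vector). The separation must be strict because its margin is split in halves: one makes
    the trace condition strict, the other makes every contact point move strictly inwards.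
    Compactness of the ball then gives one step length valid for all its points. *)

Lemma schur_decomposition n (a : R) (r : 'cV[R]_n) (B : 'M[R]_n) : a != 0 ->
  block_mx a%:M r^T r (B + a^-1 *: (r *m r^T)) =
  block_mx 1%:M 0 (a^-1 *: r) 1%:M *m
    (block_mx a%:M 0 0 B *m block_mx 1%:M (a^-1 *: r^T) 0 1%:M).
Proof.
move=> a0; rewrite !mulmx_block !(mul0mx, mulmx0, mul1mx, mulmx1, addr0, add0r).
rewrite mul_mx_scalar mul_scalar_mx !scalerA divff// !scale1r.
by rewrite scalemxAl addrC.
Qed.

(** [B] is the Schur complement of the pivot [a]. Writing a matrix in this bordered form makes
    determinant and trace computable from [a], [r] and [B] alone. *)
Lemma posdef_ind (P : forall n, 'M[R]_n -> Prop) :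
  (forall M : 'M[R]_0, P 0%N M) ->
  (forall n (a : R) (r : 'cV[R]_n) (B : 'M[R]_n), 0 < a -> posdef B -> P n B ->
     P (1 + n)%N (block_mx a%:M r^T r (B + a^-1 *: (r *m r^T)))) ->
  forall n (M : 'M[R]_n), posdef M -> P n M.
Proof.
move=> P0 PS; elim=> [|n IH] M [Msym Mpos]; first exact: P0.
pose M' : 'M[R]_(1 + n) := M.
have Mpos' (x : 'cV_(1 + n)) : x != 0 -> 0 < (x^T *m M' *m x) 0 0 by exact: Mpos.
pose a := M' 0 0; pose r : 'cV[R]_n := dlsubmx M'.
pose B := drsubmx M' - a^-1 *: (r *m r^T).
have ME : M' = block_mx a%:M r^T r (B + a^-1 *: (r *m r^T)).
  rewrite subrK -[LHS]submxK; congr block_mx.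
    by rewrite [ulsubmx M']mx11_scalar !mxE; congr (M' _ _)%:M; apply/val_inj.
  by rewrite /r trmx_dlsub; congr ursubmx.
have a_gt0 : 0 < a.
  have := Mpos' (col_mx 1%:M 0).
  rewrite ME tr_col_mx mul_row_block mul_row_col.
  rewrite !(trmx1, trmx0, mul0mx, mul1mx, mulmx0, mulmx1, addr0) !mxE eqxx mulr1n.
  apply; apply/eqP => /(congr1 (fun x => usubmx x)).
  rewrite col_mxKu -[RHS]/(usubmx (0 : 'cV_(1 + n))) raddf0 => /matrixP/(_ 0 0).
  by rewrite !mxE eqxx => /eqP; rewrite oner_eq0.
have a_neq0 : a != 0 by rewrite gt_eqF.
have pB : posdef B.
  split.
    rewrite /B linearB/= linearZ/= trmx_mul trmxK trmx_drsub; congr (drsubmx _ - _).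
    exact: Msym.
  (* This first coordinate minimises the quadratic form for the given [x]; what remains of the form
     is that of [B] at [x]. *)
  move=> x x0; pose y : 'cV[R]_(1 + n) := col_mx (- (a^-1 *: (r^T *m x))) x.
  have := Mpos' y; rewrite ME schur_decomposition//.
  have -> : y^T *m (block_mx 1%:M 0 (a^-1 *: r) 1%:M *m
    (block_mx a%:M 0 0 B *m block_mx 1%:M (a^-1 *: r^T) 0 1%:M)) *m y
    = (block_mx 1%:M (a^-1 *: r^T) 0 1%:M *m y)^T *m (block_mx a%:M 0 0 B)
      *m (block_mx 1%:M (a^-1 *: r^T) 0 1%:M *m y).
    rewrite trmx_mul tr_block_mx !linearZ/= !trmxK !trmx1 !trmx0.
    by rewrite !mulmxA.
  rewrite mul_block_col !mul1mx mul0mx add0r -scalemxAl addNr.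
  rewrite tr_col_mx mul_row_block mul_row_col.
  rewrite !(trmx0, mul0mx, mulmx0, add0r, addr0); apply.
  apply: contraNneq x0 => y0; rewrite -(col_mxKd (- (a^-1 *: (r^T *m x))) x) -/y y0.
  by rewrite -[X in dsubmx X]/(0 : 'cV[R]_(1 + n)) raddf0.
by rewrite -[M]/M' ME; apply: PS => //; exact: IH.
Qed.

Lemma det_schur n (a : R) (r : 'cV[R]_n) (B : 'M[R]_n) : a != 0 ->
  \det (block_mx a%:M r^T r (B + a^-1 *: (r *m r^T))) = a * \det B.
Proof.
move=> a0; rewrite schur_decomposition// !det_mulmx det_lblock !det1.
by rewrite !det_ublock !det1 !det_scalar1 !mul1r !mulr1.
Qed.

Lemma mxtrace_outer n (r : 'cV[R]_n) : \tr (r *m r^T) = \sum_i r i 0 ^+ 2.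
Proof.
rewrite /mxtrace; apply: eq_bigr => i _.
by rewrite !mxE big_ord1 !mxE expr2.
Qed.

Lemma ln_le_subr1 (x : R) : 0 < x -> ln x <= x - 1.
Proof. by move=> x0; rewrite -[x in ln x](subrKC 1); apply: le_ln1Dx; rewrite ltrBrDl addrN. Qed.

Lemma ln_lt_subr1 (x : R) : 0 < x -> x != 1 -> ln x < x - 1.
Proof.
move=> x0 x1.
(* Halving the logarithm: [2 (sqrt x - 1) < x - 1] unless [sqrt x = 1] *)
pose y := Num.sqrt x.
have y0 : 0 < y by rewrite sqrtr_gt0.
have xE : x = y ^+ 2 by rewrite sqr_sqrtr// ltW.
have y1 : y != 1 by apply: contraNneq x1 => y1; rewrite xE y1 expr1n.
have : ln y <= y - 1 by exact: ln_le_subr1.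
rewrite xE lnXn// => ly.
have : 0 < (y - 1) ^+ 2 by rewrite exprn_even_gt0// subr_eq0.
rewrite -mulr_natl; nra.
Qed.

Lemma posdef_det_gt0 n (M : 'M[R]_n) : posdef M -> 0 < \det M.
Proof.
move: n M; apply: posdef_ind => [M|n a r B a0 _ dB]; first by rewrite det_mx00.
by rewrite det_schur ?gt_eqF// mulr_gt0.
Qed.

Lemma mxtrace_schur n (a : R) (r : 'cV[R]_n) (B : 'M[R]_n) :
  \tr (block_mx a%:M r^T r (B + a^-1 *: (r *m r^T))) =
  a + \tr B + a^-1 * \sum_i r i 0 ^+ 2.
Proof.
by rewrite mxtrace_block mxtraceD mxtraceZ mxtrace_outer mxtrace_scalar addrA.
Qed.

(** Bordering multiplies the determinant by [a] and raises the trace by at least [a], so each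
    induction step reduces to ln a <= a - 1. *)
Lemma posdef_ln_det_le n (M : 'M[R]_n) : posdef M -> ln (\det M) <= \tr M - n%:R.
Proof.
move=> pM; move: (pM); move: n M pM.
apply: (posdef_ind (fun n M => posdef M -> ln (\det M) <= \tr M - n%:R)) =>
  [M _|n a r B a0 pB IH _].
  by rewrite det_mx00 ln1 /mxtrace big_ord0 subr0.
rewrite det_schur ?gt_eqF// lnM ?posrE ?posdef_det_gt0// mxtrace_schur natrD.
have := IH pB; have := ln_le_subr1 a a0.
have : 0 <= a^-1 * \sum_i r i 0 ^+ 2.
  by rewrite mulr_ge0 ?sumr_ge0 ?invr_ge0// => [|i _]; [exact: ltW|exact: sqr_ge0].
lra.
Qed.

(** Equality leaves no slack in any induction step: the pivot is 1, the border [r] vanishes, and [B]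
    is again an equality case. *)
Lemma posdef_ln_det_eq n (M : 'M[R]_n) : posdef M ->
  \tr M - n%:R <= ln (\det M) -> M = 1%:M.
Proof.
move: n M; apply: posdef_ind => [M _|n a r B a0 pB IH].
  by apply/matrixP => -[].
rewrite det_schur ?gt_eqF// lnM ?posrE ?posdef_det_gt0// mxtrace_schur natrD => H.
have la := ln_le_subr1 a a0; have lB := posdef_ln_det_le _ _ pB.
have s0 : 0 <= \sum_i r i 0 ^+ 2 by apply: sumr_ge0 => i _; exact: sqr_ge0.
have q0 : 0 <= a^-1 * \sum_i r i 0 ^+ 2 by rewrite mulr_ge0// invr_ge0 ltW.
have a1 : a = 1.
  by apply/eqP/negPn/negP => /(ln_lt_subr1 a a0) la'; lra.
have B1 : B = 1%:M by apply: IH; lra.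
have r0 : r = 0.
  have : a^-1 * \sum_i r i 0 ^+ 2 = 0 by apply/eqP; rewrite eq_le q0 andbT; lra.
  rewrite a1 invr1 mul1r => /eqP; rewrite psumr_eq0; last by move=> i _; exact: sqr_ge0.
  move=> /allP r0; apply/matrixP => i j; rewrite ord1 !mxE.
  by apply/eqP; rewrite -sqrf_eq0; apply: r0; rewrite mem_index_enum.
by rewrite r0 a1 B1 trmx0 mul0mx scaler0 addr0 [in RHS]scalar_mx_block.
Qed.

End PositiveDefinite.

(** * Linear change of variables in the Lebesgue integral *)

Section LinearChangeOfVariables.
Context {R : realType}.
Local Notation RT := (measurableTypeR R).

(** [Rn_integral] integrates over tuples, so measurability is that of the function after the same
    reindexing of columns by tuples. *)
Definition tmeasurable n (g : 'cV[R]_n -> \bar R) :=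
  measurable_fun [set: n.-tuple RT] (fun t => g (\col_i tnth t i)).
Arguments tmeasurable {n} g.

Lemma tmeasurable_comp n (g : 'cV[R]_n -> \bar R) dT (T : measurableType dT)
    (phi : T -> 'cV[R]_n) : tmeasurable g ->
  (forall i, measurable_fun setT (fun z => phi z i 0 : RT)) ->
  measurable_fun setT (fun z => g (phi z)).
Proof.
move=> mg mphi.
have -> : (fun z => g (phi z)) =
    (fun t : n.-tuple RT => g (\col_i tnth t i)) \o
    (fun z => [tuple phi z i 0 | i < n] : n.-tuple RT).
  apply/funext => z /=; congr g; apply/colP => i.
  by rewrite mxE tnth_mktuple.
apply: measurableT_comp => //; apply/measurable_fun_tnthP => i.
by rewrite [X in measurable_fun _ X](_ : _ = fun z => phi z i 0)//;
  apply/funext => z /=; rewrite tnth_mktuple.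
Qed.

Lemma measurable_coord n (i : 'I_n) (j : 'I_1) :
  measurable_fun setT (fun t : n.-tuple RT => (\col_i tnth t i : 'cV[R]_n) i j : RT).
Proof. by under eq_fun do rewrite mxE; exact: measurable_tnth. Qed.

Lemma measurable_affine n m dT (T : measurableType dT) (phi : T -> 'cV[R]_n)
    (M : 'M[R]_(m, n)) (b : 'cV[R]_m) i j :
  (forall i, measurable_fun setT (fun z => phi z i 0 : RT)) ->
  measurable_fun setT (fun z => (M *m phi z + b) i j : RT).
Proof.
move=> mphi; under eq_fun do rewrite !mxE.
apply: measurable_funD => //; apply: measurable_sum => k.
by rewrite !ord1; apply: measurable_funM => //; exact: mphi.
Qed.

Lemma tmeasurable_affine n m (g : 'cV[R]_m -> \bar R) (M : 'M[R]_(m, n)) b :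
  tmeasurable g -> tmeasurable (fun x => g (M *m x + b)).
Proof.
move=> mg; apply: (tmeasurable_comp _ _ _ _ _ mg) => i.
by apply: measurable_affine => k; exact: measurable_coord.
Qed.

Lemma col_cons_pair n (p : RT * n.-tuple RT) :
  \col_i tnth (cons_pair p) i =
  col_mx (p.1%:M : 'cV[R]_1) (\col_i tnth p.2 i) :> 'cV[R]_(1 + n).
Proof.
apply/colP => i; rewrite -[i]splitK; case: (fintype.split i) => j /=.
  by rewrite [RHS]col_mxEu !mxE !ord1 eqxx mulr1n.
rewrite [RHS]col_mxEd !mxE.
have -> : rshift 1 j = lift ord0 j by apply/val_inj.
by rewrite tnthS; congr tnth; apply/val_inj.
Qed.

Lemma tmeasurable_cons_pair n (g : 'cV[R]_(1 + n) -> \bar R) : tmeasurable g ->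
  measurable_fun setT (fun p : RT * n.-tuple RT =>
    g (col_mx (p.1%:M : 'cV[R]_1) (\col_i tnth p.2 i))).
Proof.
move=> mg; under eq_fun do rewrite -col_cons_pair.
by apply: measurableT_comp mg _; exact: measurable_cons_pair.
Qed.

Lemma Rn_integralS n (g : 'cV[R]_(1 + n) -> \bar R) :
  tmeasurable g -> (forall x, 0 <= g x)%E ->
  Rn_integral g =
  (\int[lebesgue_measure \x lebesgue_tuple n]_p
    g (col_mx (p.1%:M : 'cV[R]_1) (\col_i tnth p.2 i)))%E.
Proof.
move=> mg g0; rewrite /Rn_integral /= /push_cons.
rewrite ge0_integral_pushforward//=; last exact: measurable_cons_pair.
by apply: eq_integral => p _ /=; rewrite col_cons_pair.
Qed.

(** Both orders of Tonelli are needed: lower triangular factors are integrated with the head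
    coordinate outermost, upper ones with it innermost. *)
Lemma Rn_integralS_head n (g : 'cV[R]_(1 + n) -> \bar R) :
  tmeasurable g -> (forall x, 0 <= g x)%E ->
  Rn_integral g = (\int[lebesgue_measure]_(x in [set: RT])
    Rn_integral (fun y : 'cV[R]_n => g (col_mx x%:M y)))%E.
Proof.
move=> mg g0; rewrite Rn_integralS// fubini_tonelli1//.
exact: tmeasurable_cons_pair.
Qed.

Lemma Rn_integralS_tail n (g : 'cV[R]_(1 + n) -> \bar R) :
  tmeasurable g -> (forall x, 0 <= g x)%E ->
  Rn_integral g = Rn_integral (fun y : 'cV[R]_n =>
    \int[lebesgue_measure]_(x in [set: RT]) g (col_mx x%:M y))%E.
Proof.
move=> mg g0; rewrite Rn_integralS// fubini_tonelli2//.
exact: tmeasurable_cons_pair.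
Qed.

Lemma tmeasurable_tail_integral n (g : 'cV[R]_(1 + n) -> \bar R) :
  tmeasurable g -> (forall x, 0 <= g x)%E ->
  tmeasurable (fun y : 'cV[R]_n =>
    \int[lebesgue_measure]_(x in [set: RT]) g (col_mx x%:M y))%E.
Proof.
move=> mg g0.
exact: (measurable_fun_fubini_tonelli_G _ (tmeasurable_cons_pair _ _ mg)).
Qed.

Lemma measurable_head_integral n (g : 'cV[R]_(1 + n) -> \bar R) :
  tmeasurable g -> (forall x, 0 <= g x)%E ->
  measurable_fun setT (fun x : RT =>
    Rn_integral (fun y : 'cV[R]_n => g (col_mx x%:M y))).
Proof.
move=> mg g0.
exact: (measurable_fun_fubini_tonelli_F _ (tmeasurable_cons_pair _ _ mg)).
Qed.

Lemma measurable_affine1 (a b : R) : measurable_fun setT (fun x : RT => a * x + b : RT).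
Proof. by apply: measurable_funD => //; exact: measurable_funM. Qed.

Lemma integral_affine (a b : R) (g : R -> \bar R) : 0 < a ->
  measurable_fun [set: RT] g -> (forall x, 0 <= g x)%E ->
  (\int[lebesgue_measure]_(x in [set: RT]) g (a * x + b)%R =
   (a^-1)%:E * \int[lebesgue_measure]_(x in [set: RT]) g x)%E.
Proof.
move=> a0 mg g0; have ai0 : 0 <= a by exact: ltW.
pose phi (x : RT) : RT := a * x + b.
have mphi : measurable_fun setT phi := measurable_affine1 a b.
(* Lebesgue measure is determined by its values on half-open intervals, and there it agrees with [a]
   times its image under the affine map. *)
pose push := pushforward lebesgue_measure phi : {measure set RT -> \bar R}.
pose mu : {measure set RT -> \bar R} := mscale (NngNum ai0) (push mphi).
have muE A : measurable A -> lebesgue_measure A = mu A.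
  move: A; apply: lebesgue_measure_unique => _ [[u v] _ <-].
  rewrite /mu /= /mscale /= /push /= /pushforward.
  have -> : phi @^-1` `]u, v] = `](u - b) / a, (v - b) / a]%classic.
    apply/seteqP; split => x /=; rewrite !in_itv /= /phi;
    by rewrite ltr_pdivrMr// ler_pdivlMr// ltrBlDr lerBrDr mulrC.
  rewrite !lebesgue_measure_itv /= !lte_fin ltr_pM2r ?invr_gt0// ltrD2r.
  case: ifPn => _; last by rewrite mule0.
  rewrite -!EFinB -EFinM; congr (_%:E).
  by field; rewrite gt_eqF.
transitivity (\int[push mphi]_(x in [set: RT]) g x)%E.
  by rewrite ge0_integral_pushforward.
rewrite [in RHS](eq_measure_integral mu); last by move=> A mA _; exact: muE.
rewrite ge0_integral_mscale//= muleA -EFinM mulVf ?mul1e//.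
by rewrite gt_eqF.
Qed.

(** The constant [c] stands for the inverse of the absolute determinant. The shift [b] is part of
    the property because slicing a triangular map produces a shift that depends on the fixed
    coordinates. *)
Definition scales_integral n (M : 'M[R]_n) (c : R) := forall g b,
  tmeasurable g -> (forall x, 0 <= g x)%E ->
  Rn_integral (fun x => g (M *m x + b)) = (c%:E * Rn_integral g)%E.
Arguments scales_integral {n} M c.

Lemma Rn_integral_ge0 n (g : 'cV[R]_n -> \bar R) :
  (forall x, 0 <= g x)%E -> (0 <= Rn_integral g)%E.
Proof. by move=> g0; exact: integral_ge0. Qed.

Lemma tmeasurable_section n (g : 'cV[R]_(1 + n) -> \bar R) (x : R) :
  tmeasurable g -> tmeasurable (fun y : 'cV[R]_n => g (col_mx x%:M y)).
Proof.
move=> mg; apply: (tmeasurable_comp _ _ _ _ _ mg) => i.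
rewrite -[i]splitK; case: (fintype.split i) => j /=.
  by under eq_fun do rewrite col_mxEu; exact: measurable_cst.
by under eq_fun do rewrite col_mxEd; exact: measurable_coord.
Qed.

Lemma measurable_section_head n (g : 'cV[R]_(1 + n) -> \bar R) (y : 'cV[R]_n) :
  tmeasurable g -> measurable_fun [set: RT] (fun x => g (col_mx x%:M y)).
Proof.
move=> mg; apply: (tmeasurable_comp _ _ _ _ _ mg) => i.
rewrite -[i]splitK; case: (fintype.split i) => j /=.
  under eq_fun do rewrite col_mxEu !mxE !ord1 eqxx mulr1n.
  exact: measurable_id.
by under eq_fun do rewrite col_mxEd; exact: measurable_cst.
Qed.

Lemma scales_integral_mul n (M N : 'M[R]_n) c e :
  scales_integral M c -> scales_integral N e -> scales_integral (M *m N) (e * c).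
Proof.
move=> HM HN g b mg g0; rewrite EFinM -muleA -(HM g b)//.
rewrite -[in RHS](HN (fun x => g (M *m x + b)) 0)//; last exact: tmeasurable_affine.
by congr Rn_integral; apply/funext => x; rewrite addr0 mulmxA.
Qed.

(** With the head [x] fixed, the tail undergoes [B] followed by a shift depending on [x], which
    [scales_integral B c] absorbs; the outer integral is then one-dimensional. *)
Lemma scales_integral_lower n (a : R) (r : 'cV[R]_n) (B : 'M[R]_n) (c : R) :
  0 < a -> 0 <= c -> scales_integral B c ->
  scales_integral (block_mx a%:M 0 r B : 'M[R]_(1 + n)) (a^-1 * c).
Proof.
move=> a0 c0 HB g b mg g0; pose b' : 'cV[R]_(1 + n) := b.
pose b1 : R := usubmx b' 0 0.
rewrite Rn_integralS_head//; last exact: tmeasurable_affine.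
have E x : Rn_integral (fun y : 'cV[R]_n =>
     g ((block_mx a%:M 0 r B : 'M[R]_(1 + n)) *m col_mx x%:M y + b)) =
   (c%:E * Rn_integral (fun y : 'cV[R]_n => g (col_mx (a * x + b1)%R%:M y)))%E.
  rewrite -(HB _ (r *m x%:M + dsubmx b'))//; last exact: tmeasurable_section.
  congr Rn_integral; apply/funext => y; congr g.
  rewrite -[b]/b' -[b' in LHS]vsubmxK mul_block_col mul0mx addr0 add_col_mx.
  congr col_mx; last by rewrite [RHS]addrA (addrC (B *m y)).
  rewrite -scalar_mxM raddfD/=; congr (_ + _).
  by rewrite [LHS]mx11_scalar.
under eq_integral do rewrite E.
rewrite (Rn_integralS_head _ g)//.
have mh := measurable_head_integral _ g mg g0.
rewrite (integral_affine a b1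
  (fun z => c%:E * Rn_integral (fun y : 'cV[R]_n => g (col_mx z%:M y)))%E)//.
- rewrite ge0_integralZl//; first by rewrite muleA -EFinM.
  by move=> x _; exact: Rn_integral_ge0.
- exact: measurable_funeM.
- by move=> x; rewrite mule_ge0//; exact: Rn_integral_ge0.
Qed.

(** For the identity matrix the property is translation invariance. *)
Lemma scales_integral1 n : scales_integral (1%:M : 'M[R]_n) 1.
Proof.
elim: n => [|n IH].
  move=> g b _ _; rewrite mul1e; congr Rn_integral; apply/funext => x.
  by congr g; apply/matrixP => -[].
have := scales_integral_lower n 1 0 1%:M 1 ltr01 ler01 IH.
by rewrite -scalar_mx_block invr1 mulr1.
Qed.

(** With the tail [y] fixed, the head is merely translated by an amount depending on [y]. *)
Lemma scales_integral_upper n (r : 'rV[R]_n) :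
  scales_integral (block_mx 1%:M r 0 1%:M : 'M[R]_(1 + n)) 1.
Proof.
move=> g b mg g0; pose b' : 'cV[R]_(1 + n) := b.
rewrite mul1e Rn_integralS_tail//; last exact: tmeasurable_affine.
have mh := tmeasurable_tail_integral _ g mg g0.
rewrite (Rn_integralS_tail _ g)//.
rewrite -[RHS]mul1e -(scales_integral1 n _ (dsubmx b') mh); last first.
  by move=> x; exact: integral_ge0.
congr Rn_integral; apply/funext => y.
have m1 := measurable_section_head _ g (1%:M *m y + dsubmx b') mg.
rewrite -[RHS]mul1e -[X in (X%:E * _)%E]invr1.
rewrite -(integral_affine 1 ((r *m y + usubmx b') 0 0) _ ltr01 m1)//.
apply: eq_integral => x _; congr g.
rewrite -[b]/b' -[b' in LHS]vsubmxK mul_block_col mul0mx add0r add_col_mx mul1r.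
by congr col_mx; rewrite raddfD/= -mx11_scalar mul1mx addrA.
Qed.

(** In the Schur factorisation the two unit triangular shears preserve integrals; only the diagonal
    block contributes. *)
Lemma scales_integral_posdef n (M : 'M[R]_n) :
  posdef M -> scales_integral M (\det M)^-1.
Proof.
move: n M; apply: posdef_ind => [M|n a r B a0 pB IH].
  rewrite det_mx00 invr1 (_ : M = 1%:M); first exact: scales_integral1.
  by apply/matrixP => -[].
rewrite det_schur ?gt_eqF// schur_decomposition ?gt_eqF//.
have HL := scales_integral_lower _ 1 (a^-1 *: r) _ _ ltr01 ler01 (scales_integral1 n).
have HD : scales_integral (block_mx a%:M 0 0 B : 'M[R]_(1 + n)) (a^-1 * (\det B)^-1).
  by apply: scales_integral_lower => //; rewrite invr_ge0 ltW// posdef_det_gt0.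
have HU := scales_integral_upper _ (a^-1 *: r^T).
have := scales_integral_mul _ _ _ _ _ HL (scales_integral_mul _ _ _ _ _ HD HU).
by rewrite invr1 !mulr1 mul1r invfM.
Qed.

End LinearChangeOfVariables.
Arguments tmeasurable {R n} g.
Arguments scales_integral {R n} M c.

(** * The s-volume of an ellipsoid *)

Section EllipsoidVolume.
Context {R : realType}.
Local Notation RT := (measurableTypeR R).

Definition nsq n (v : 'cV[R]_n) : R := \sum_i v i 0 ^+ 2.
Arguments nsq {n} v.

Lemma nsq_ge0 n (v : 'cV[R]_n) : 0 <= nsq v.
Proof. by apply: sumr_ge0 => i _; exact: sqr_ge0. Qed.

Lemma nsq_eq0 n (v : 'cV[R]_n) : nsq v = 0 -> v = 0.
Proof.
move/eqP; rewrite psumr_eq0 => [|i _]; last exact: sqr_ge0.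
move=> /allP v0; apply/colP => i; rewrite !mxE; apply/eqP.
by rewrite -sqrf_eq0; apply: v0; rewrite mem_index_enum.
Qed.

Lemma nsq_dot n (v : 'cV[R]_n) : nsq v = (v^T *m v) 0 0.
Proof. by rewrite mxE; apply: eq_bigr => i _; rewrite mxE expr2. Qed.

Lemma nsq_col_mx m n (u : 'cV[R]_m) (v : 'cV[R]_n) :
  nsq (col_mx u v) = nsq u + nsq v.
Proof.
rewrite /nsq big_split_ord /=.
by congr (_ + _); apply: eq_bigr => i _; rewrite ?col_mxEu ?col_mxEd.
Qed.

Lemma nsq_scalar (x : R) : nsq (x%:M : 'cV_1) = x ^+ 2.
Proof. by rewrite /nsq big_ord1 mxE eqxx mulr1n. Qed.

Lemma nsqN n (v : 'cV[R]_n) : nsq (- v) = nsq v.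
Proof. by apply: eq_bigr => i _; rewrite mxE sqrrN. Qed.

Lemma nsqZ n (a : R) (v : 'cV[R]_n) : nsq (a *: v) = a ^+ 2 * nsq v.
Proof. by rewrite mulr_sumr; apply: eq_bigr => i _; rewrite mxE exprMn. Qed.

Lemma nsq_lift n (x : 'cV[R]_n) xi : nsq (lift_pt x xi) = nsq x + xi ^+ 2.
Proof. by rewrite /lift_pt nsq_col_mx nsq_scalar. Qed.

Lemma ballE n (v : 'cV[R]_n) : euclidean_ball n v = (nsq v <= 1) :> Prop.
Proof. by []. Qed.

(** The s-th power of the half-chord over [y] in the ball of squared radius [r]. Square roots of
    negative numbers are 0, so for s > 0 it vanishes outside the ball. The radius is a parameter
    because fixing one coordinate [x] turns [r] into [r - x ^+ 2]. *)
Definition ball_profile (s r : R) n (y : 'cV[R]_n) : \bar R :=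
  ((Num.sqrt (r - nsq y)) `^ s)%:E.
Arguments ball_profile s r {n} y.

Lemma ball_profile_ge0 s r n (y : 'cV[R]_n) : (0 <= ball_profile s r y)%E.
Proof. by rewrite lee_fin powR_ge0. Qed.

Lemma tmeasurable_ball_profile s r n : tmeasurable (@ball_profile s r n).
Proof.
apply/measurable_EFinP.
apply: (measurableT_comp (measurable_powR s)).
apply: (@measurableT_comp _ _ _ _ _ _ (@Num.sqrt R)).
  apply: continuous_measurable_fun. exact: sqrt_continuous.
apply: measurable_funB => //; apply: measurable_sum => i.
by apply: measurable_funX; exact: measurable_coord.
Qed.

Lemma ball_profile_col_mx s r n x (y : 'cV[R]_n) :
  ball_profile s r (col_mx (x%:M : 'cV_1) y) = ball_profile s (r - x ^+ 2) y.
Proof. by rewrite /ball_profile nsq_col_mx nsq_scalar opprD addrA. Qed.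

Lemma ball_profile_le s r r' n (y : 'cV[R]_n) : 0 <= s -> r <= r' ->
  (ball_profile s r y <= ball_profile s r' y)%E.
Proof.
move=> s0 rr'; rewrite lee_fin ge0_ler_powR ?nnegrE ?sqrtr_ge0//.
by rewrite ler_wsqrtr// lerB.
Qed.

Lemma ball_profile_eq0 s r n (y : 'cV[R]_n) : 0 < s -> r <= 0 ->
  ball_profile s r y = 0%E.
Proof.
move=> s0 r0; rewrite /ball_profile ler0_sqrtr ?powR0 ?gt_eqF//.
by rewrite subr_le0 (le_trans r0)// nsq_ge0.
Qed.

Lemma Rn_integral_le n (f g : 'cV[R]_n -> \bar R) :
  tmeasurable f -> tmeasurable g -> (forall x, 0 <= f x)%E ->
  (forall x, f x <= g x)%E -> (Rn_integral f <= Rn_integral g)%E.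
Proof. by move=> mf mg f0 fg; apply: ge0_le_integral => //= t _; apply: le_trans (fg _). Qed.

Lemma Rn_integralZl n (k : R) (g : 'cV[R]_n -> \bar R) : 0 <= k ->
  tmeasurable g -> (forall x, 0 <= g x)%E ->
  Rn_integral (fun x => k%:E * g x)%E = (k%:E * Rn_integral g)%E.
Proof. by move=> k0 mg g0; exact: ge0_integralZl. Qed.

(** Positivity and finiteness allow the volume of the ball to be cancelled when s-volumes are
    compared. In the induction, slices with x^2 <= r/2 keep squared radius at least r/2, which
    bounds the integral below; slices with |x| > r + 1 vanish and all others are at most the slice
    at 0, which bounds it above. *)
Lemma ball_profile_integral_bounds s n r : 0 < s -> 0 < r ->
  (0 < Rn_integral (@ball_profile s r n) < +oo)%E.
Proof.
move=> s0; elim: n r => [|n IH] r r0.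
  rewrite /Rn_integral /= integral_dirac//; last exact: tmeasurable_ball_profile.
  rewrite diracT mul1e ltry andbT lte_fin powR_gt0// sqrtr_gt0.
  by rewrite /nsq big_ord0 subr0.
have mh r' m := tmeasurable_ball_profile s r' m.
have h0 r' m := @ball_profile_ge0 s r' m.
rewrite -[n.+1]/(1 + n)%N Rn_integralS_head//.
have mH := measurable_head_integral _ _ (mh r (1 + n)%N) (h0 r (1 + n)%N).
have H0 x : (0 <= Rn_integral (fun y : 'cV_n => ball_profile s r (col_mx (x%:M : 'cV_1) y)))%E.
  by apply: Rn_integral_ge0 => y; exact: h0.
have HE x : Rn_integral (fun y : 'cV_n => ball_profile s r (col_mx (x%:M : 'cV_1) y)) =
    Rn_integral (@ball_profile s (r - x ^+ 2) n).
  by congr Rn_integral; apply/funext => y; rewrite ball_profile_col_mx.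
have indic_int (b : R) (c : \bar R) : 0 <= b -> (0 <= c)%E ->
    (\int[lebesgue_measure]_(x in [set: RT]) (c * (\1_(`[- b, b]%classic) x)%:E) =
     c * (b *+ 2)%:E)%E.
  move=> b0 c0; rewrite ge0_integralZl//; last first.
    by apply/measurable_EFinP; exact: measurable_indic.
  rewrite integral_indic// setIT; congr (_ * _)%E.
  rewrite -[LHS]/(lebesgue_measure (`[- b, b]%classic : set RT)).
  rewrite lebesgue_measure_itv /= lte_fin.
  case: ltP => bb; first by rewrite -EFinB opprK mulr2n.
  have -> : b = 0 by lra.
  by rewrite mul0rn.
have mindic (b : R) (c : \bar R) : measurable_fun [set: RT]
    (fun x => c * (\1_(`[- b, b]%classic) x)%:E)%E.
  by apply: measurable_funeM; apply/measurable_EFinP; exact: measurable_indic.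
have /andP[Ir0 Iroo] := IH r r0.
have /andP[Iq0 Iqoo] := IH (r / 2) ltac:(lra).
apply/andP; split.
  pose b := Num.sqrt (r / 2).
  have b0 : 0 < b by rewrite sqrtr_gt0; lra.
  apply: (@lt_le_trans _ _ (Rn_integral (@ball_profile s (r / 2) n) * (b *+ 2)%:E)%E).
    by rewrite mule_gt0// lte_fin mulrn_wgt0.
  rewrite -(indic_int b _ (ltW b0) (ltW Iq0)).
  apply: ge0_le_integral; first exact: measurableT.
  - by move=> x _; rewrite mule_ge0 ?(ltW Iq0)// lee_fin indicE ler0n.
  - exact: mindic.
  - exact: mH.
  move=> x _; rewrite indicE.
  case: (boolP (_ \in _)) => xb; last by rewrite mule0; exact: H0.
  rewrite mule1 HE.
  apply: Rn_integral_le; [exact: mh|exact: mh|exact: h0|move=> y].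
  apply: ball_profile_le; first exact: ltW.
  move: xb; rewrite inE /= in_itv /= => /andP[bx xb].
  have : b ^+ 2 = r / 2 by rewrite sqr_sqrtr//; lra.
  nra.
apply: (@le_lt_trans _ _ (Rn_integral (@ball_profile s r n) * ((r + 1) *+ 2)%:E)%E); last first.
  apply: lte_mul_pinfty.
  - exact: (ltW Ir0).
  - rewrite (ge0_fin_numE (ltW Ir0)); exact: Iroo.
  - exact: ltry.
have r1 : 0 <= r + 1 by lra.
rewrite -(indic_int _ _ r1 (ltW Ir0)).
apply: ge0_le_integral; first exact: measurableT.
- by move=> x _; exact: H0.
- exact: mH.
- exact: mindic.
move=> x _; rewrite HE indicE.
case: (boolP (_ \in _)) => xb.
  rewrite mule1.
  apply: Rn_integral_le; [exact: mh|exact: mh|exact: h0|move=> y].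
  by apply: ball_profile_le; [exact: ltW | rewrite gerBl sqr_ge0].
rewrite mule0 (_ : Rn_integral _ = 0%E)//.
rewrite /Rn_integral; apply: integral0_eq => t _; apply: ball_profile_eq0 => //.
move: xb; rewrite notin_setE /= in_itv /= => /negP; rewrite negb_and -!ltNge => /orP[|]; nra.
Qed.

Lemma ellipsoid_block_lift n (A : 'M[R]_n) (alpha : R) (a x : 'cV[R]_n) (xi : R) :
  A \in unitmx -> alpha != 0 ->
  ellipsoid (block_mx A 0 0 alpha%:M, a) (lift_pt x xi) <->
  nsq (invmx A *m (x - a)) + (xi / alpha) ^+ 2 <= 1.
Proof.
move=> uA al0; split.
  move=> [v]; rewrite ballE -[v]vsubmxK; set y := usubmx v; set w := dsubmx v.
  rewrite nsq_col_mx => vb; rewrite /= /lift_pt mul_block_col !mul0mx add0r addr0.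
  rewrite add_col_mx => /eq_col_mx[<- wE].
  rewrite addrK mulKmx//; move: wE vb; rewrite mul_scalar_mx [w]mx11_scalar.
  rewrite nsq_scalar => /matrixP/(_ 0 0); rewrite !mxE eqxx !mulr1n addr0 => <-.
  by rewrite mulrAC divff// mul1r.
move=> H; exists (col_mx (invmx A *m (x - a)) (xi / alpha)%:M).
  by rewrite ballE nsq_col_mx nsq_scalar.
rewrite /= /lift_pt mul_block_col !mul0mx add0r addr0 add_col_mx; congr col_mx.
  by rewrite mulKVmx// subrK.
by rewrite -scalar_mxM -raddfD/= addr0 mulrC divfK.
Qed.

Lemma posdef_unitmx n (A : 'M[R]_n) : posdef A -> A \in unitmx.
Proof. by move=> pA; rewrite unitmxE unitfE gt_eqF// posdef_det_gt0. Qed.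

Lemma posdef_invmx n (A : 'M[R]_n) : posdef A -> posdef (invmx A).
Proof.
move=> pA; have uA := posdef_unitmx _ _ pA; have [As Ap] := pA.
have Ais : (invmx A)^T = invmx A by rewrite trmx_inv As.
split=> // x x0; have := Ap (invmx A *m x); rewrite trmx_mul Ais -!mulmxA mulKVmx//.
apply; apply: contraNneq x0 => /(congr1 (mulmx A)).
by rewrite mulKVmx// mulmx0 => ->.
Qed.

(** The half-chord over x is alpha times that of the unit ball over A^-1 (x - a). The change of
    variables by A^-1 brings out det A. *)
Lemma s_volume_ellipsoid n s (A : 'M[R]_n) (alpha : R) (a : 'cV[R]_n) :
  0 < s -> posdef A -> 0 < alpha ->
  s_volume s (ellipsoid (block_mx A 0 0 alpha%:M, a)) =
  ((\det A * alpha `^ s)%:E * Rn_integral (@ball_profile s 1 n))%E.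
Proof.
move=> s0 pA al0; have uA := posdef_unitmx _ _ pA.
have sE : s_volume s (ellipsoid (block_mx A 0 0 alpha%:M, a)) =
    Rn_integral (fun x => ((alpha `^ s)%:E *
      ball_profile s 1 (invmx A *m x + - (invmx A *m a)))%E).
  congr Rn_integral; apply/funext => x; rewrite -mulmxBr.
  set q := nsq (invmx A *m (x - a)).
  have -> : [set xi | ellipsoid (block_mx A 0 0 alpha%:M, a) (lift_pt x xi)] =
      [set xi | q + (xi / alpha) ^+ 2 <= 1].
    by apply/seteqP; split=> xi; rewrite /mkset ellipsoid_block_lift ?gt_eqF.
  have -> : lebesgue_measure [set xi | q + (xi / alpha) ^+ 2 <= 1] =
      (alpha * Num.sqrt (1 - q) *+ 2)%:E.
    have [q1|q1] := leP q 1; last first.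
      rewrite ler0_sqrtr ?subr_le0 ?(ltW q1)// mulr0 mul0rn.
      rewrite (_ : [set _ | _] = set0) ?measure0//.
      by apply/seteqP; split=> xi //=; have := sqr_ge0 (xi / alpha); lra.
    set m := alpha * Num.sqrt (1 - q).
    have m0 : 0 <= m by rewrite mulr_ge0 ?sqrtr_ge0 ?ltW.
    have -> : [set xi | q + (xi / alpha) ^+ 2 <= 1] = `[- m, m]%classic.
      apply/seteqP; split=> xi /=; rewrite in_itv /= -ler_norml -lerBrDl => H.
        rewrite /m -ler_pdivrMl// mulrC -[X in _ / X]gtr0_norm// -normf_div.
        by rewrite -sqrtr_sqr ler_sqrt ?subr_ge0.
      rewrite -ler_sqrt ?subr_ge0// sqrtr_sqr normf_div (gtr0_norm al0).
      by rewrite ler_pdivrMr// mulrC.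
    rewrite lebesgue_measure_itv /= lte_fin; case: ltP => mm.
      by rewrite -EFinB opprK mulr2n.
    have -> : m = 0 by lra.
    by rewrite mul0rn.
  rewrite -EFinM poweR_EFin -EFinM; congr (_%:E).
  by rewrite -(mulr_natl (alpha * _) 2) mulKf ?pnatr_eq0// powRM ?sqrtr_ge0// ltW.
rewrite sE Rn_integralZl; first last.
- by move=> x; exact: ball_profile_ge0.
- exact: (tmeasurable_affine _ _ _ _ _ (tmeasurable_ball_profile s 1 n)).
- exact: powR_ge0.
rewrite (scales_integral_posdef _ _ (posdef_invmx _ _ pA)); first last.
- exact: ball_profile_ge0.
- exact: tmeasurable_ball_profile.
by rewrite det_inv invrK muleA -EFinM (mulrC (alpha `^ s)).
Qed.

Lemma posdef1 n : posdef (1%:M : 'M[R]_n).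
Proof.
split; first exact: trmx1.
move=> x x0; rewrite mulmx1 -nsq_dot lt0r nsq_ge0 andbT.
by apply: contraNneq x0 => /nsq_eq0 ->.
Qed.

Lemma ellipsoid1 n : ellipsoid ((1%:M : 'M[R]_(n + 1)), (0 : 'cV[R]_n)) =
  euclidean_ball (n + 1).
Proof.
have l0 : lift_pt (0 : 'cV[R]_n) 0 = 0 by rewrite /lift_pt raddf0 col_mx0.
apply/seteqP; split=> [_ [v vb <-]|v vb] /=.
  by rewrite l0 addr0 mul1mx.
by exists v => //=; rewrite l0 addr0 mul1mx.
Qed.

Lemma s_volume_ball n s : 0 < s ->
  s_volume s (euclidean_ball (n + 1)) = Rn_integral (@ball_profile s 1 n).
Proof.
move=> s0; rewrite -ellipsoid1 (scalar_mx_block n 1) s_volume_ellipsoid//.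
  by rewrite det1 powR1 mulr1 mul1e.
exact: posdef1.
Qed.

End EllipsoidVolume.
Arguments nsq {R n} v.
Arguments ball_profile {R} s r {n} y.

(** * Convex combinations or strict separation *)

Section ConvexAlternative.
Context {R : realType}.

Lemma continuous_sum (T : topologicalType) (J : Type) (r : seq J) (F : J -> T -> R) :
  (forall j, continuous (F j)) -> continuous (fun z => \sum_(j <- r) F j z).
Proof.
move=> cF; elim: r => [|j r IH] z.
  by under eq_fun do rewrite big_nil; exact: cvg_cst.
under eq_fun do rewrite big_cons.
by apply: cvgD; [exact: cF|exact: IH].
Qed.

Lemma continuous_mul (T : topologicalType) (f g : T -> R) :
  continuous f -> continuous g -> continuous (fun z => f z * g z).
Proof. by move=> cf cg z; apply: cvgM; [exact: cf|exact: cg]. Qed.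

Lemma continuous_sqr (T : topologicalType) (f : T -> R) :
  continuous f -> continuous (fun z => f z ^+ 2).
Proof. by move=> cf; apply: (continuous_mul _ f f). Qed.

Lemma continuous_affine (T : topologicalType) (f : T -> R) (a b : R) :
  continuous f -> continuous (fun z => a * (f z - b)).
Proof.
move=> cf z; apply: cvgM; first exact: cvg_cst.
by apply: cvgB; [exact: cf|exact: cvg_cst].
Qed.

(** The k + 1 vectors (1, phi (u i)) live in dimension 1 + |I| <= k, hence satisfy a linear relation
    [w]. Subtracting a multiple of [w] from the weights preserves all sums, and the multiple is
    chosen so that one weight drops to 0. *)
Lemma caratheodory_step (T : Type) (I : finType) (phi : T -> I -> R) k
    (u : 'I_k.+1 -> T) (l : 'I_k.+1 -> R) :
  (#|I| < k)%N -> (forall i, 0 <= l i) ->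
  exists (u' : 'I_k -> T) (l' : 'I_k -> R),
    [/\ forall i, exists j, u' i = u j, forall i, 0 <= l' i,
        \sum_i l' i = \sum_i l i
      & forall x, \sum_i l' i * phi (u' i) x = \sum_i l i * phi (u i) x].
Proof.
move=> Ik l0.
pose M : 'M[R]_(k.+1, 1 + #|I|) := \matrix_(i, j)
  match fintype.split j with inl _ => 1 | inr y => phi (u i) (enum_val y) end.
have : kermx M != 0.
  rewrite kermx_eq0 /row_free neq_ltn (leq_ltn_trans (rank_leq_col M))//.
move=> /rowV0Pn[w /sub_kermxP wM w0].
have sw : \sum_i w 0 i = 0.
  have /matrixP/(_ 0 (lshift _ 0)) := wM; rewrite !mxE => {2}<-.
  apply: eq_bigr => i _; rewrite mxE.
  by rewrite (unsplitK (inl _ : 'I_1 + 'I_#|I|)) mulr1.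
have sp x : \sum_i w 0 i * phi (u i) x = 0.
  have /matrixP/(_ 0 (rshift _ (enum_rank x))) := wM; rewrite !mxE => {2}<-.
  apply: eq_bigr => i _; rewrite mxE.
  by rewrite (unsplitK (inr _ : 'I_1 + 'I_#|I|)) enum_rankK.
have [i0 wi0] : exists i, 0 < w 0 i.
  apply/not_existsP => wle; move/negP: w0; apply; apply/eqP/rowP => i.
  have wle0 j : 0 <= - w 0 j by rewrite oppr_ge0 leNgt; apply/negP/wle.
  have : \sum_i - w 0 i == 0 by rewrite sumrN sw oppr0.
  rewrite psumr_eq0// => /allP/(_ i); rewrite mem_index_enum oppr_eq0 mxE.
  by move=> /(_ isT) /eqP.
(* The least ratio l i / w i over the positive entries of [w] is the first moment at which a weight
   vanishes, so no weight has become negative. *)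
have [i1 wi1 imin] := @arg_minP _ R _ i0 (fun i => 0 < w 0 i) (fun i => l i / w 0 i) wi0.
pose t := l i1 / w 0 i1.
have t0 : 0 <= t by rewrite divr_ge0// ltW.
pose l1 i := l i - t * w 0 i.
have l1i1 : l1 i1 = 0 by rewrite /l1 /t divfK ?subrr// gt_eqF.
have l1_ge0 i : 0 <= l1 i.
  rewrite subr_ge0; have [wi|wi] := ltP 0 (w 0 i).
    by rewrite -ler_pdivlMr//; exact: imin.
  by rewrite (le_trans _ (l0 i))// mulr_ge0_le0.
have lift_sum (F : 'I_k.+1 -> R) : F i1 = 0 ->
    \sum_(i < k) F (lift i1 i) = \sum_i F i.
  by move=> F0; rewrite (bigD1_ord i1)//= F0 add0r.
exists (u \o lift i1), (l1 \o lift i1); split.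
- by move=> i; exists (lift i1 i).
- by move=> i; exact: l1_ge0.
- rewrite (lift_sum l1)// /l1 big_split/= sumrN -mulr_sumr sw mulr0 oppr0.
  by rewrite addr0.
- move=> x; rewrite (lift_sum (fun i => l1 i * phi (u i) x)) ?l1i1 ?mul0r//.
  under eq_bigr do rewrite /l1 mulrBl -mulrA.
  by rewrite big_split/= sumrN -mulr_sumr sp mulr0 oppr0 addr0.
Qed.

(* The second alternative comes from the point of least norm of the convex
   hull, which exists because Caratheodory's theorem makes the hull compact. *)
Lemma convex_combination_or_separation (U : topologicalType) (I : finType)
    (C : set U) (phi : U -> I -> R) :
  compact C -> (forall x, continuous (fun u => phi u x)) ->
  (exists (u : 'I_#|I|.+1 -> U) (l : 'I_#|I|.+1 -> R),
    [/\ forall i, C (u i), forall i, 0 <= l i, \sum_i l i = 1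
      & forall x, \sum_i l i * phi (u i) x = 0]) \/
  (exists (w : I -> R) (e : R), 0 < e /\
    forall u, C u -> e <= \sum_x w x * phi u x).
Proof.
move=> cC cphi; have [[u0 Cu0]|C0] := pselect (C !=set0); last first.
  by right; exists (fun=> 0), 1; split=> // u Cu; case: C0; exists u.
set m := #|I|.+1.
pose X := prod_topology (fun _ : 'I_m => (U * R)%type).
pose comb (f : X) x := \sum_i (f i).2 * phi (f i).1 x.
pose g (f : X) := \sum_x comb f x * comb f x.
have fst_c i : continuous (fun f : X => (f i).1).
  move=> f; apply: (cvg_comp (fun f : X => f i) fst); first exact: proj_continuous.
  exact: cvg_fst.
have snd_c i : continuous (fun f : X => (f i).2).
  move=> f; apply: (cvg_comp (fun f : X => f i) snd); first exact: proj_continuous.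
  exact: cvg_snd.
have comb_c x : continuous (comb^~ x).
  apply: continuous_sum => i; apply: continuous_mul; first exact: snd_c.
  move=> f; apply: (cvg_comp (fun f : X => (f i).1) (phi^~ x)); first exact: fst_c.
  exact: cphi.
have g_c : continuous g.
  by apply: continuous_sum => x; apply: continuous_mul; exact: comb_c.
pose P := [set f : X | forall i, (C `*` `[0, 1]%classic) (f i)]
  `&` [set f : X | \sum_i (f i).2 = 1].
have cP : compact P.
  apply: compact_closedI.
    apply: (@tychonoff 'I_m (fun=> (U * R)%type) (fun=> C `*` `[0, 1]%classic)).
    by move=> i; apply: compact_setX => //; exact: segment_compact.
  apply: (@closed_comp _ _ (fun f : X => \sum_i (f i).2) [set 1]).
    by move=> f _; apply: continuous_sum => i; exact: snd_c.
  exact: closed_eq.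
have P0 : P !=set0.
  exists (fun i => (u0, if i == ord0 then 1 else 0)); split=> [i|] /=.
    by split=> //=; rewrite in_itv /=; case: ifP; rewrite ?lexx ler01.
  by rewrite (bigD1 ord0)//= big1 ?addr0// => i /negPf ->.
have [z /[!inE] -[Pz sz] zmin] := compact_EVT_min P0 cP (continuous_subspaceT g_c).
have [gz|gz] := eqVneq (g z) 0.
  left; exists (fun i => (z i).1), (fun i => (z i).2); split=> //.
  - by move=> i; have [] := Pz i.
  - by move=> i; have [_ /=] := Pz i; rewrite in_itv /= => /andP[].
  - move=> x; move/eqP: gz; rewrite psumr_eq0 => [|y _]; last exact: sqr_ge0.
    by move=> /allP/(_ x); rewrite mem_index_enum mulf_eq0 orbb => /(_ isT) /eqP.
right; exists (comb z), (g z); split.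
  by rewrite lt0r gz /= sumr_ge0// => x _; exact: sqr_ge0.
move=> u Cu; set a := \sum_x _ ; pose b := \sum_x phi u x * phi u x.
(* Mixing [u] into the minimiser with weight [t] gives a combination of |I| + 2 points; one
   Caratheodory step brings it back into [P], where minimality of [z] applies. *)
have key t : 0 < t -> t <= 1 ->
    g z <= (1 - t) ^+ 2 * g z + 2 * t * (1 - t) * a + t ^+ 2 * b.
  move=> t0 t1.
  pose v (i : 'I_m.+1) : U := if unlift ord0 i is Some j then (z j).1 else u.
  pose l (i : 'I_m.+1) : R := if unlift ord0 i is Some j then (1 - t) * (z j).2 else t.
  have l0 i : 0 <= l i.
    rewrite /l; case: unliftP => [j _|_]; last exact: ltW.
    have [_ /=] := Pz j; rewrite in_itv /= => /andP[zj _].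
    by rewrite mulr_ge0// subr_ge0.
  have [v' [l' [v'v l'0 sl' cl']]] := caratheodory_step U I phi m v l (leqnn _) l0.
  have sl : \sum_i l i = 1.
    rewrite big_ord_recl /l unlift_none.
    under eq_bigr do rewrite liftK.
    by rewrite -mulr_sumr sz mulr1 addrC subrK.
  have Cv i : C (v i).
    by rewrite /v; case: unliftP => [j _|_] //; have [] := Pz j.
  have Pf : P (fun i => (v' i, l' i)).
    split=> [i|]; last by rewrite /= sl' sl.
    split=> /=; first by have [j ->] := v'v i; exact: Cv.
    rewrite in_itv /= l'0 /=; apply: (@le_trans _ _ (\sum_j l' j)).
      by rewrite (bigD1 i)//= lerDl sumr_ge0// => j _; exact: l'0.
    by rewrite sl' sl.
  have := zmin _ (mem_set Pf).
  have -> : g (fun i => (v' i, l' i)) =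
    \sum_x ((1 - t) * comb z x + t * phi u x) * ((1 - t) * comb z x + t * phi u x).
    apply: eq_bigr => x _.
    have -> : comb (fun i => (v' i, l' i)) x = (1 - t) * comb z x + t * phi u x.
      rewrite /comb /= cl' big_ord_recl /l /v unlift_none addrC mulr_sumr.
      by congr (_ + _); apply: eq_bigr => i _; rewrite liftK mulrA.
    by [].
  move=> /le_trans; apply; rewrite /g /a /b !mulr_sumr -!big_split /=.
  by apply: ler_sum => x _; rewrite le_eqVlt; apply/orP; left; apply/eqP; ring.
(* Letting [t -> 0] in [key] gives [g z <= a]. *)
rewrite leNgt; apply/negP => az.
have b0 : 0 <= b by apply: sumr_ge0 => x _; exact: sqr_ge0.
have g0 : 0 <= g z by apply: sumr_ge0 => x _; exact: sqr_ge0.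
pose c := g z - a; have c0 : 0 < c by rewrite subr_gt0.
(* [D] dominates both c and c - a + b, so t = c / D is at most 1 and the inequality at [t] would
   give 2c <= c. *)
pose D := g z + b + 2 * `|a| + 2 * c.
have a0 := normr_ge0 a; have la := ler_norm a;
have Na : - a <= `|a| by rewrite -normrN ler_norm.
have D0 : 0 < D by rewrite /D; lra.
have t0 : 0 < c / D by rewrite divr_gt0.
have t1 : c / D <= 1 by rewrite ler_pdivrMr// mul1r /D; lra.
have := key _ t0 t1; set t := c / D.
have tD : t * D = c by rewrite /t divfK// gt_eqF.
have -> : g z = a + c by rewrite /c; lra.
move=> H; have : t * (2 * c) <= t * (t * (c - a + b)) by move: H; lra.
rewrite ler_pM2l// => H2.
have : t * (c - a + b) <= t * D.
  by rewrite ler_pM2l// /D; lra.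
by rewrite tD; lra.
Qed.

End ConvexAlternative.

(** * The tangent inequality at a contact point *)

Section Contact.
Context {R : realType}.

Definition dot n (u v : 'cV[R]_n) : R := (u^T *m v) 0 0.
Arguments dot {n} u v.

Lemma dotDr n (u v w : 'cV[R]_n) : dot u (v + w) = dot u v + dot u w.
Proof. by rewrite /dot mulmxDr mxE. Qed.

Lemma dotZr n a (u v : 'cV[R]_n) : dot u (a *: v) = a * dot u v.
Proof. by rewrite /dot -scalemxAr mxE. Qed.

Lemma dotC n (u v : 'cV[R]_n) : dot u v = dot v u.
Proof. by rewrite /dot !mxE; apply: eq_bigr => i _; rewrite !mxE mulrC. Qed.

Lemma dot_sumr n k (a : 'I_k -> R) (u : 'cV[R]_n) (v : 'I_k -> 'cV[R]_n) :
  dot u (\sum_i a i *: v i) = \sum_i a i * dot u (v i).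
Proof.
rewrite /dot mulmx_sumr summxE; apply: eq_bigr => i _.
by rewrite -scalemxAr mxE.
Qed.

Lemma dotvv n (v : 'cV[R]_n) : dot v v = nsq v.
Proof. by rewrite nsq_dot. Qed.

Lemma nsqD n (u v : 'cV[R]_n) : nsq (u + v) = nsq u + 2 * dot u v + nsq v.
Proof.
by rewrite -!dotvv dotDr !(dotC _ (u + v)) !dotDr (dotC _ v u); ring.
Qed.

Lemma nsq_sub_scale n (x y : 'cV[R]_n) t :
  nsq (x - t *: y) = nsq x - 2 * t * dot x y + t ^+ 2 * nsq y.
Proof. by rewrite nsqD nsqN nsqZ -scaleNr dotZr; ring. Qed.

Lemma continuous_nsq n : continuous (@nsq R n).
Proof.
apply: continuous_sum => i; apply: (continuous_sqr _ (fun v : 'cV[R]_n => v i 0)).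
exact: coord_continuous.
Qed.

Lemma lift_ptK n (u : 'cV[R]_(n + 1)) : lift_pt (usubmx u) (dsubmx u 0 0) = u.
Proof. by rewrite /lift_pt -mx11_scalar vsubmxK. Qed.

Lemma s_lifting_lift_pt n s (f : 'cV[R]_n -> R) x xi :
  s_lifting s f (lift_pt x xi) <-> `|xi| <= f x `^ s^-1.
Proof.
split=> [[x' [xi' [/eq_col_mx[-> /matrixP/(_ 0 0)]]]]|H]; last by exists x, xi.
by rewrite !mxE eqxx !mulr1n => ->.
Qed.

Lemma bd_ball n (u : 'cV[R]_n) : bd (euclidean_ball n) u <-> nsq u = 1.
Proof.
split=> [[ub ui]|u1].
  apply/eqP; rewrite eq_le; apply/andP; split.
    have cb : closed [set v : 'cV[R]_n | nsq v <= 1].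
      apply: (@closed_comp _ _ (@nsq R n) [set x | x <= 1]); last exact: closed_le.
      by move=> v _; exact: continuous_nsq.
    by move: ub; rewrite -(closure_id _).1.
  rewrite leNgt; apply/negP => u1; apply: ui.
  rewrite /interior; near=> v; rewrite ballE; apply: ltW; near: v.
  exact: (cvgr_lt _ (@continuous_nsq n u)).
split; first by apply: (@subset_closure _ (euclidean_ball n)); rewrite ballE u1.
move=> ui; have sc : (fun t : R => t *: u) @ (1 : R)^'+ --> u.
  rewrite -[X in _ --> X]scale1r.
  by apply: (cvg_at_right_filter (f := fun t : R => t *: u)); apply: cvgZr_tmp; exact: cvg_id.
near (1 : R)^'+ => t.
have t1 : 1 < t by near: t; exact: nbhs_right_gt.
have : euclidean_ball n (t *: u) by near: t; exact: (sc _ ui).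
by rewrite ballE nsqZ u1 mulr1; apply/negP; rewrite -ltNge exprn_egt1.
Unshelve. all: by end_near. Qed.

(** In logarithmic height e, membership in the lifting reads psi x <= - s e, the epigraph of a
    convex function; the value +oo of [psi] covers the zeros of [f]. *)
Lemma log_concave_lifting n s (f : 'cV[R]_n -> R) y z a b t :
  0 < s -> log_concave f -> 0 <= t <= 1 ->
  expR a <= f y `^ s^-1 -> expR b <= f z `^ s^-1 ->
  expR (t * a + (1 - t) * b) <= f (t *: y + (1 - t) *: z) `^ s^-1.
Proof.
move=> s0 [psi [psiN psi_cvx fE]] t01.
have key x e : expR e <= f x `^ s^-1 <-> (psi x <= (- (s * e))%:E)%E.
  have := fE x; have := psiN x; case: (psi x) => [r| |]//= _ [->].
    rewrite /powR gt_eqF ?expR_gt0// expRK ler_expR lee_fin.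
    by rewrite mulrC ler_pdivlMr// lerNr mulrC.
  rewrite powR0 ?invr_eq0 ?gt_eqF// leNgt expR_gt0 leye_eq.
  by split.
move/andP: (t01) => [t0 t1].
rewrite !key => Ha Hb; apply: (le_trans (psi_cvx _ _ _ t01)).
apply: (@le_trans _ _ (t%:E * (- (s * a))%:E + (1 - t)%:E * (- (s * b))%:E)%E).
  by apply: leeD; apply: lee_wpmul2l => //; rewrite lee_fin ?subr_ge0.
by rewrite -!EFinM -EFinD lee_fin le_eqVlt; apply/orP; left; apply/eqP; ring.
Qed.

(** Degree three is what the polynomial [B] in [tangent_scaling] requires; lower degrees are padded
    with zero coefficients. *)
Lemma cubic_gt0_near (a b c e : R) : 0 < a ->
  \forall t \near 0^'+, 0 < a + b * t + c * t ^+ 2 + e * t ^+ 3.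
Proof.
move=> a0; have c0 : (fun t : R => a + b * t + c * t ^+ 2 + e * t ^+ 3) @ 0^'+ --> a.
  apply: cvg_at_right_filter.
  rewrite -[X in _ --> X](_ : a + b * 0 + c * 0 ^+ 2 + e * 0 ^+ 3 = a); last by ring.
  apply: cvgD; last by apply: cvgM; [exact: cvg_cst|exact: exprn_continuous].
  apply: cvgD; last by apply: cvgM; [exact: cvg_cst|exact: exprn_continuous].
  by apply: cvgD; [exact: cvg_cst|apply: cvgM; [exact: cvg_cst|exact: cvg_id]].
exact: (cvgr_gt _ c0 _ a0).
Qed.

Lemma continuous_expR_ln (a b r : R) : r < 1 ->
  {for r, continuous (fun r : R => expR (a + b * (2^-1 * ln (1 - r))))}.
Proof.
move=> r1; apply: (@continuous_comp _ _ _ (fun r : R => a + b * (2^-1 * ln (1 - r))) expR);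
  last exact: continuous_expR.
apply: cvgD; first exact: cvg_cst.
apply: cvgM; first exact: cvg_cst.
apply: cvgM; first exact: cvg_cst.
apply: (@continuous_comp _ _ _ (fun r : R => 1 - r) (@ln R)).
  by apply: cvgB; [exact: cvg_cst|exact: cvg_id].
by apply: continuous_ln; rewrite subr_gt0.
Qed.

(* If the tangent inequality fails at [y], then [x = t y + (1 - t) z] with [z] in
   the open unit ball, and log-concavity along the segment from [z] to [y] forces
   [f^(1/s)] to exceed [|xi|] at [x]. *)
Lemma tangent_scaling (n : nat) (x y : 'cV[R]_n) (xi eta : R) :
  nsq x + xi ^+ 2 = 1 -> 0 < eta ->
  1 < dot x y + xi ^+ 2 * (1 + ln eta - ln `|xi|) ->
  exists t, let z := (1 - t)^-1 *: (x - t *: y) in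
  [/\ 0 < t < 1, nsq z < 1 & `|xi| < expR (t * ln eta + (1 - t) * (2^-1 * ln (1 - nsq z)))].
Proof.
move=> x1 eta0 H; set l := ln `|xi| in H; set le := ln eta in H *.
(* [Q t] is (1 - t)^2 - |x - t y|^2 expanded in powers of t, that is (1 - t)^2 (1 - |z|^2). *)
pose q := xi ^+ 2; pose m := 1 - dot x y; pose k := 1 - nsq y; pose C := le - l.
pose Q t := q + (- 2 * m) * t + k * t ^+ 2 + 0 * t ^+ 3.
have QE t : t < 1 -> 1 - nsq ((1 - t)^-1 *: (x - t *: y)) = Q t / (1 - t) ^+ 2.
  move=> t1; rewrite nsqZ nsq_sub_scale /Q /q /m /k.
  have -> : nsq x = 1 - xi ^+ 2 by rewrite -x1; ring.
  by field; rewrite subr_eq0 eq_sym lt_eqF.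
have lnt (t : R) : 0 < t -> t < 1 -> ln (1 - t) <= - t.
  by move=> t0 t1; apply: le_ln1Dx; rewrite ltrN2.
(* On the equator the hypothesis says x.y > 1, so Q t / t tends to -2m > 0, and the height condition
   only asks an exponential to be positive. *)
have [xi0|xi0] := eqVneq xi 0.
  have m0 : 0 < -2 * m by move: H; rewrite /m xi0 expr0n /= mul0r; lra.
  near (0 : R)^'+ => t.
  have t0 : 0 < t by near: t; exact: nbhs_right_gt.
  have t1 : t < 1 by near: t; exact: nbhs_right_lt.
  exists t; split; first by rewrite t0.
  - rewrite -subr_gt0 QE// divr_gt0 ?exprn_gt0 ?subr_gt0//.
    have -> : Q t = t * (- 2 * m + k * t + 0 * t ^+ 2 + 0 * t ^+ 3).
      by rewrite /Q /q xi0; ring.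
    rewrite mulr_gt0//; near: t; exact: cubic_gt0_near.
  - by rewrite xi0 normr0 expR_gt0.
have q0 : 0 < q by rewrite exprn_even_gt0.
have lq : ln q = 2 * l.
  by rewrite /q /l -real_normK ?num_real// lnXn ?normr_gt0// mulr_natl.
(* Once the logarithms are replaced by rational bounds, the excess of logarithmic height is at least
   t B(t) / (2 Q(t)). The constant coefficient of [B] is positive exactly by the failed tangent
   inequality. *)
pose B t := (2 * (q * (C + 1) - m)) + (- 4 * m * (C + 1) - 2 * q + k + 2 * m) * t
  + (2 * k * (C + 1) + 4 * m - k) * t ^+ 2 + (- 2 * k) * t ^+ 3.
near (0 : R)^'+ => t.
have t0 : 0 < t by near: t; exact: nbhs_right_gt.
have t1 : t < 1 by near: t; exact: nbhs_right_lt.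
have Qt : 0 < Q t by near: t; exact: cubic_gt0_near.
have Bt : 0 < B t.
  near: t; apply: cubic_gt0_near; move: H; rewrite /m /C /q; lra.
have t1' : 0 < 1 - t by rewrite subr_gt0.
exists t; split; first by rewrite t0.
  by rewrite -subr_gt0 QE// divr_gt0 ?exprn_gt0.
rewrite QE// -[X in X < _]lnK ?posrE ?normr_gt0// ltr_expR -/l.
have -> : ln (Q t / (1 - t) ^+ 2) = ln (Q t) - 2 * ln (1 - t).
  by rewrite ln_div ?posrE ?exprn_gt0// lnXn// mulr_natl.
have L1 : ln q - ln (Q t) <= q / Q t - 1.
  by rewrite -ln_div ?posrE//; apply: ln_le_subr1; rewrite divr_gt0.
have L2 := lnt t t0 t1.
have L3 : 2 * l + (1 - q / Q t) + 2 * t <= ln (Q t) - 2 * ln (1 - t).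
  by move: L1; rewrite lq; lra.
have L4 : (1 - t) * (2^-1 * (2 * l + (1 - q / Q t) + 2 * t)) <=
  (1 - t) * (2^-1 * (ln (Q t) - 2 * ln (1 - t))).
  by rewrite !ler_pM2l ?invr_gt0.
apply: lt_le_trans (lerD (lexx (t * le)) L4).
rewrite -subr_gt0.
have -> : t * le + (1 - t) * (2^-1 * (2 * l + (1 - q / Q t) + 2 * t)) - l =
    t * B t / (2 * Q t).
  have -> : B t = 2 * Q t * (C + 1 - t) + (1 - t) * (- 2 * m + k * t).
    by rewrite /B /Q; ring.
  have -> : q = Q t - t * (- 2 * m + k * t) by rewrite /Q; ring.
  have Qn0 : Q t != 0 by rewrite gt_eqF.
  by rewrite /C; move: (Q t) Qn0 => Z Z0; field.
by rewrite divr_gt0 ?mulr_gt0.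
Unshelve. all: by end_near. Qed.

(** The strict inequalities of [tangent_scaling] persist when [t] and [y] are kept and the contact
    point is moved slightly, so a violation would place a whole neighbourhood of it inside the
    lifting. *)
Lemma contact_inequality (n : nat) (s : R) (f : 'cV[R]_n -> R)
    (x y : 'cV[R]_n) (xi eta : R) :
  0 < s -> log_concave f -> euclidean_ball (n + 1) `<=` s_lifting s f ->
  nsq x + xi ^+ 2 = 1 -> ~ (s_lifting s f)° (lift_pt x xi) ->
  0 < eta -> s_lifting s f (lift_pt y eta) ->
  dot x y + xi ^+ 2 * (1 + ln eta - ln `|xi|) <= 1.
Proof.
move=> s0 lcf ballK x1 xint eta0 Ky; rewrite leNgt; apply/negP => H; apply: xint.
have [t [/andP[t0 t1] z1 xiz]] := tangent_scaling n x y xi eta x1 eta0 H.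
pose z (v : 'cV[R]_(n + 1)) := (1 - t)^-1 *: (usubmx v - t *: y).
pose h v := expR (t * ln eta + (1 - t) * (2^-1 * ln (1 - nsq (z v)))).
have zl : z (lift_pt x xi) = (1 - t)^-1 *: (x - t *: y) by rewrite /z col_mxKu.
have cz : continuous (fun v => nsq (z v)).
  apply: continuous_sum => i; apply: (continuous_sqr _ (fun v => z v i 0)).
  have -> : (fun v => z v i 0) =
      (fun v => (1 - t)^-1 * (v (lshift 1 i) 0 - t * y i 0)).
    by apply/funext => v; rewrite /z !mxE.
  apply: (continuous_affine _ (fun v : 'cV[R]_(n + 1) => v (lshift 1 i) 0)).
  exact: coord_continuous.
have clast : continuous (fun v : 'cV[R]_(n + 1) => dsubmx v 0 0).
  by move=> v; under eq_fun do rewrite mxE; exact: coord_continuous.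
have ch : h @ lift_pt x xi --> h (lift_pt x xi).
  apply: (cvg_comp (fun v => nsq (z v))
    (fun r : R => expR (t * ln eta + (1 - t) * (2^-1 * ln (1 - r)))) (cz _)).
  by apply: continuous_expR_ln; rewrite zl.
have n1 : \forall v \near lift_pt x xi, nsq (z v) < 1.
  by apply: (cvgr_lt _ (cz _)); rewrite zl.
have n2 : \forall v \near lift_pt x xi, 0 < h v - `|dsubmx v 0 0|.
  apply: (cvgr_gt _ (cvgB ch (cvg_norm (clast _)))).
  by rewrite subr_gt0 /h zl /lift_pt col_mxKd mxE eqxx mulr1n.
near=> v; rewrite -[v]lift_ptK s_lifting_lift_pt.
have zv1 : nsq (z v) < 1 by near: v.
have : 0 < h v - `|dsubmx v 0 0| by near: v.
rewrite subr_gt0 => /ltW /le_trans; apply.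
have -> : usubmx v = t *: y + (1 - t) *: z v.
  rewrite /z scalerA divff; last by rewrite subr_eq0 eq_sym lt_eqF.
  by rewrite scale1r addrC subrK.
apply: log_concave_lifting => //; first by rewrite !ltW.
  rewrite lnK ?posrE//; move: Ky; rewrite s_lifting_lift_pt.
  by apply: le_trans; exact: ler_norm.
have u0 : 0 < 1 - nsq (z v) by rewrite subr_gt0.
have : s_lifting s f (lift_pt (z v) (expR (2^-1 * ln (1 - nsq (z v))))).
  apply: ballK; rewrite ballE nsq_lift -expRM_natl mulrA divff// mul1r lnK//.
  by rewrite addrC subrK.
rewrite s_lifting_lift_pt; apply: le_trans; exact: ler_norm.
Unshelve. all: by end_near. Qed.

End Contact.
Arguments dot {R n} u v.

(** * Contact points bound the volume *)

Section JohnSufficient.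
Context {R : realType}.

Lemma john_sums (d k : nat) (s : R) (u : 'I_k -> 'cV[R]_(d + 1)) (c : 'I_k -> R) :
  \sum_i c i *: (u i *m (u i)^T) = block_mx 1%:M 0 0 s%:M ->
  (forall M : 'M[R]_d,
     \sum_i c i * dot (usubmx (u i)) (M *m usubmx (u i)) = \tr M) /\
  \sum_i c i * dsubmx (u i) 0 0 ^+ 2 = s.
Proof.
have uE i : u i *m (u i)^T = block_mx
    (usubmx (u i) *m (usubmx (u i))^T) (usubmx (u i) *m (dsubmx (u i))^T)
    (dsubmx (u i) *m (usubmx (u i))^T) (dsubmx (u i) *m (dsubmx (u i))^T).
  by rewrite -mul_col_row -tr_col_mx vsubmxK.
move=> sumE; split.
  move=> M; have : \sum_i c i *: (usubmx (u i) *m (usubmx (u i))^T) = 1%:M.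
    apply/matrixP => p q; move/matrixP/(_ (lshift 1 p) (lshift 1 q)): sumE.
    rewrite block_mxEul summxE => <-; rewrite summxE; apply: eq_bigr => i _.
    by rewrite mxE [RHS]mxE uE block_mxEul.
  move=> S1; rewrite -[M in RHS]mulmx1 -S1 mulmx_sumr (raddf_sum (@mxtrace R d)).
  apply: eq_bigr => i _.
  rewrite /= -scalemxAr mxtraceZ; congr (_ * _).
  rewrite mulmxA mxtrace_mulC /dot [X in \tr X]mx11_scalar mxtrace_scalar.
  by rewrite mulr1n.
move/matrixP/(_ (rshift d 0) (rshift d 0)): sumE; rewrite block_mxEdr summxE.
rewrite [s%:M _ _]mxE eqxx mulr1n => <-; apply: eq_bigr => i _.
by rewrite [RHS]mxE uE block_mxEdr !mxE big_ord1 !mxE expr2.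
Qed.

Lemma ellipsoid_image (d : nat) (A : 'M[R]_d) (alpha : R) (a v : 'cV[R]_d) (w : R) :
  nsq v + w ^+ 2 <= 1 ->
  ellipsoid (block_mx A 0 0 alpha%:M, a) (lift_pt (A *m v + a) (alpha * w)).
Proof.
move=> vw; exists (lift_pt v w); first by rewrite ballE nsq_lift.
rewrite /= /lift_pt mul_block_col !mul0mx add0r addr0 add_col_mx.
by rewrite -scalar_mxM raddf0 addr0.
Qed.

(** The tangent inequality is tested at the image (A x + a, alpha |xi|) of the contact point raised
    to height |xi|; ln |xi| then cancels. *)
Lemma contact_ellipsoid (d : nat) (s : R) (f : 'cV[R]_d -> R) (x a : 'cV[R]_d)
    (xi alpha : R) (A : 'M[R]_d) :
  0 < s -> log_concave f -> euclidean_ball (d + 1) `<=` s_lifting s f ->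
  nsq x + xi ^+ 2 = 1 -> ~ (s_lifting s f)° (lift_pt x xi) ->
  posdef A -> 0 < alpha ->
  ellipsoid (block_mx A 0 0 alpha%:M, a) `<=` s_lifting s f ->
  dot x (A *m x) + dot x a + xi ^+ 2 * (1 + ln alpha) <= 1.
Proof.
move=> s0 lcf ballK x1 xint pA al0 EK.
have ineq v w : nsq v + w ^+ 2 <= 1 -> 0 < w ->
    dot x (A *m v) + dot x a + xi ^+ 2 * (1 + ln (alpha * w) - ln `|xi|) <= 1.
  move=> vw w0; rewrite -dotDr.
  apply: (contact_inequality _ _ _ _ _ _ _ s0 lcf ballK x1 xint).
    by rewrite mulr_gt0.
  by apply: EK; exact: ellipsoid_image.
have [xi0|xi0] := eqVneq xi 0; last first.
  have axi : 0 < `|xi| by rewrite normr_gt0.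
  have := ineq x `|xi|; rewrite real_normK ?num_real// x1 => /(_ (lexx _) axi).
  by rewrite lnM ?posrE// addrA addrK.
(* The image of an equatorial contact point has height [0], so [contact_inequality]
   only applies to points approaching it from inside the ellipsoid. *)
have nx : nsq x = 1 by rewrite -x1 xi0 expr0n addr0.
pose e := dot x (A *m x); pose g := dot x a.
have e0 : 0 <= e.
  have [x0|x0] := eqVneq x 0; first by rewrite /e x0 /dot mulmx0 mulmx0 mxE.
  by rewrite ltW//; have := pA.2 x x0; rewrite /e /dot mulmxA.
rewrite -/e -/g xi0 expr0n mul0r addr0 leNgt; apply/negP => H.
pose k := e + g - 1; have k0 : 0 < k by rewrite /k; lra.
have D0 : 0 < k + e + 1 by lra.
(* Shrinking x to (1 - q) x makes room for a positive height and costs only q e, which is less than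
   the excess k because q (k + e + 1) = k. *)
pose q := k / (k + e + 1).
have q0 : 0 < q by rewrite divr_gt0.
have q1 : q < 1 by rewrite ltr_pdivrMr// mul1r; lra.
have qD : q * (k + e + 1) = k by rewrite /q divfK// gt_eqF.
have r2 : 0 < 1 - (1 - q) ^+ 2 by nra.
have := ineq ((1 - q) *: x) (Num.sqrt (1 - (1 - q) ^+ 2)).
rewrite nsqZ nx mulr1 sqr_sqrtr ?(ltW r2)// subrKC sqrtr_gt0 => /(_ (lexx _) r2).
rewrite -scalemxAr dotZr -/e -/g xi0 expr0n mul0r addr0.
move: qD; rewrite /k; nra.
Qed.

(** In the equality case A = 1 and alpha = 1, the tangent inequalities reduce to x_i.a <= 0. Their
    weighted sum is 0, so all vanish, and |a|^2 is the weighted sum of the (x_i.a)^2. *)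
Lemma john_volume_le (d k : nat) (s : R) (f : 'cV[R]_d -> R) (A : 'M[R]_d)
    (alpha : R) (a : 'cV[R]_d) :
  0 < s -> log_concave f -> euclidean_ball (d + 1) `<=` s_lifting s f ->
  john_condition s (s_lifting s f) k ->
  posdef A -> 0 < alpha ->
  ellipsoid (block_mx A 0 0 alpha%:M, a) `<=` s_lifting s f ->
  ln (\det A) + s * ln alpha <= 0 /\
  (0 <= ln (\det A) + s * ln alpha -> [/\ A = 1%:M, alpha = 1 & a = 0]).
Proof.
move=> s0 lcf ballK [u [c [uC c0 sumE sum0]]] pA al0 EK.
have [sumx sumxi] := john_sums _ _ _ _ _ sumE.
pose x i := usubmx (u i); pose xi i := dsubmx (u i) 0 0.
have u1 i : nsq (x i) + xi i ^+ 2 = 1.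
  by rewrite -nsq_lift lift_ptK; apply/bd_ball; have [] := uC i.
have uint i : ~ (s_lifting s f)° (lift_pt (x i) (xi i)).
  by rewrite lift_ptK; have [_ []] := uC i.
have T i := contact_ellipsoid _ _ _ _ _ _ _ _ s0 lcf ballK (u1 i) (uint i) pA al0 EK.
have suma : \sum_i c i * dot (x i) a = 0.
  under eq_bigr do rewrite dotC.
  by rewrite -dot_sumr sum0 /dot mulmx0 mxE.
have sumc : \sum_i c i = d%:R + s.
  rewrite -sumxi -(mxtrace_scalar d 1) -sumx -big_split /=; apply: eq_bigr => i _.
  by rewrite -mulrDr mul1mx dotvv u1 mulr1.
have trA : \tr A - d%:R + s * ln alpha <= 0.
  have : \sum_i c i * (dot (x i) (A *m x i) + dot (x i) a + xi i ^+ 2 * (1 + ln alpha))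
      <= \sum_i c i by apply: ler_sum => i _; rewrite ler_piMr// ltW.
  have E i : c i * (dot (x i) (A *m x i) + dot (x i) a + xi i ^+ 2 * (1 + ln alpha)) =
      c i * dot (x i) (A *m x i) + c i * dot (x i) a + c i * xi i ^+ 2 * (1 + ln alpha).
    by ring.
  rewrite (eq_bigr _ (fun i _ => E i)) 2!big_split/= sumx suma -mulr_suml sumxi sumc addr0; nra.
have lA := posdef_ln_det_le _ _ pA.
split; first by lra.
move=> H; have A1 : A = 1%:M by apply: posdef_ln_det_eq => //; lra.
move: H trA lA; rewrite A1 det1 ln1 mxtrace_scalar subrr add0r => sl0 sl0' _.
have la : ln alpha = 0.
  by apply: (mulfI (lt0r_neq0 s0)); apply/eqP; rewrite mulr0 eq_le sl0'; lra.
have al1 : alpha = 1 by apply/eqP; rewrite -ln_eq0// la.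
split=> //.
have xa i : dot (x i) a <= 0.
  have := T i; rewrite A1 mul1mx la addr0 mulr1 dotvv.
  by have := u1 i; lra.
have xa0 i : dot (x i) a = 0.
  have cx j : 0 <= - (c j * dot (x j) a).
    by rewrite oppr_ge0 mulr_ge0_le0// ltW.
  have : \sum_j - (c j * dot (x j) a) == 0 by rewrite sumrN suma oppr0.
  rewrite psumr_eq0// => /allP/(_ i); rewrite mem_index_enum oppr_eq0 mulf_eq0.
  by rewrite gt_eqF//= => /(_ isT) /eqP.
apply: nsq_eq0; have := sumx (a *m a^T); rewrite mxtrace_outer -/(nsq a) => <-.
rewrite big1// => i _.
by rewrite /dot -mulmxA mulmxA mxE big_ord1 -/(dot (x i) a) xa0 mul0r mulr0.
Qed.

End JohnSufficient.

(** * Perturbations of the ball *)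

Section Perturbation.
Context {R : realType}.

Lemma sqr_coord_le n (v : 'cV[R]_n) i : v i 0 ^+ 2 <= nsq v.
Proof. by rewrite /nsq (bigD1 i)//= lerDl sumr_ge0// => j _; exact: sqr_ge0. Qed.

Lemma continuous_mx (T : topologicalType) m n (f : T -> 'M[R]_(m, n)) :
  (forall i j, continuous (fun z => f z i j)) -> continuous f.
Proof.
move=> cf z A [P MP PA].
have H : \forall z' \near z, forall ij : 'I_m * 'I_n, P ij.1 ij.2 (f z' ij.1 ij.2).
  by apply: filter_forall => ij; exact: (cf _ _ z _ (MP _ _)).
by apply: (filterS _ H) => z' Pz'; apply: PA => i j; exact: (Pz' (i, j)).
Qed.

Lemma continuous_trmx m n : continuous (@trmx R m n).
Proof.
apply: continuous_mx => i j.
by under eq_fun do rewrite mxE; exact: coord_continuous.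
Qed.

Lemma continuous_mulmxr m n p (M : 'M[R]_(m, n)) :
  continuous (fun X : 'M[R]_(n, p) => M *m X).
Proof.
apply: continuous_mx => i j.
have -> : (fun X : 'M[R]_(n, p) => (M *m X) i j) =
    (fun X => \sum_k M i k * (X k j - 0)).
  by apply/funext => X; rewrite mxE; apply: eq_bigr => k _; rewrite subr0.
apply: continuous_sum => k.
apply: (continuous_affine _ (fun X : 'M[R]_(n, p) => X k j)).
exact: coord_continuous.
Qed.

Lemma compact_ball n : compact (@euclidean_ball R n).
Proof.
have -> : @euclidean_ball R n =
    trmx @` ([set v : 'rV[R]_n | forall i, `[-1, 1]%classic (v ord0 i)] `&`
             [set v | nsq v^T <= 1]).
  apply/seteqP; split=> [v vb|_ [v [_ /= vb] <-]//]; exists v^T; last exact: trmxK.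
  split; last by rewrite /= trmxK.
  move=> i /=; rewrite in_itv /= mxE.
  have := sqr_coord_le n v i; have : nsq v <= 1 by [].
  by move=> v1 vi; apply/andP; split; nra.
apply: continuous_compact; first exact/continuous_subspaceT/continuous_trmx.
apply: compact_closedI.
  apply: (@rV_compact R n (fun=> (`[-1, 1]%classic : set R))).
  by move=> i; exact: segment_compact.
apply: (@closed_comp _ _ (fun v : 'rV[R]_n => nsq v^T) [set x | x <= 1]); last exact: closed_le.
move=> v _; apply: (cvg_comp (@trmx R 1 n) (@nsq R n)); first exact: continuous_trmx.
exact: continuous_nsq.
Qed.

Lemma dot_mulmx_le n (H : 'M[R]_n) (x : 'cV[R]_n) :
  `|dot x (H *m x)| <= (\sum_i \sum_j `|H i j|) * nsq x.
Proof.
rewrite /dot mxE mulr_suml; apply: le_trans (ler_norm_sum _ _ _) _.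
apply: ler_sum => i _; rewrite !mxE mulr_sumr mulr_suml.
apply: le_trans (ler_norm_sum _ _ _) _; apply: ler_sum => j _.
rewrite mulrCA normrM ler_wpM2l// normrM.
have := sqr_coord_le n x i; have := sqr_coord_le n x j.
rewrite -[x i 0 ^+ 2]real_normK ?num_real// -[x j 0 ^+ 2]real_normK ?num_real//.
by have := sqr_ge0 (`|x i 0| - `|x j 0|); nra.
Qed.

(** Up to the factor t^n, this determinant is the characteristic polynomial of -H at 1/t, whose two
    leading coefficients are 1 and tr H. A polynomial remainder makes continuity in t immediate. *)
Lemma det_add1_scale n (H : 'M[R]_n) : exists r : {poly R}, forall t, t != 0 ->
  \det (1%:M + t *: H) = 1 + t * \tr H + t ^+ 2 * r.[t].
Proof.
case: n H => [|n] H.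
  exists 0 => t _; rewrite det_mx00 horner0 /mxtrace big_ord0; ring.
pose p := char_poly (- H).
exists (\sum_(i < n) p`_i *: 'X^(n.-1 - i)) => t t0.
have -> : \det (1%:M + t *: H) = t ^+ n.+1 * p.[t^-1].
  have -> : p.[t^-1] = \det (t^-1%:M + H).
    rewrite -[LHS]/(horner_eval t^-1 p) -det_map_mx; congr (\det _).
    apply/matrixP => i j; rewrite !mxE /horner_eval /=.
    by rewrite horner_evalE hornerD hornerN hornerC hornerMn hornerX opprK.
  rewrite -detZ scalerDr; congr (\det (_ + _)).
  by rewrite scale_scalar_mx divff.
rewrite (@horner_coef_wide _ n.+2); last by rewrite size_char_poly.
rewrite big_ord_recr big_ord_recr /=.
have -> : p`_n = \tr H.
  have := @char_poly_trace _ n.+1 (- H) isT.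
  by rewrite raddfN opprK.
have -> : p`_n.+1 = 1.
  have /monicP := char_poly_monic (- H).
  by rewrite lead_coefE size_char_poly.
have pow m : t ^+ m * t^-1 ^+ m = 1 by rewrite -exprMn divff// expr1n.
set S := \sum_(i < n) p`_i * _; set r := \sum_(i < n) _ *: _.
have -> : t ^+ n.+1 * (S + \tr H * t^-1 ^+ n + 1 * t^-1 ^+ n.+1) =
    t ^+ n.+1 * S + t * (t ^+ n * t^-1 ^+ n) * \tr H + t ^+ n.+1 * t^-1 ^+ n.+1.
  by rewrite !exprS; ring.
rewrite !pow; have -> : t ^+ n.+1 * S = t ^+ 2 * r.[t].
  rewrite horner_sum !mulr_sumr; apply: eq_bigr => i _.
  rewrite hornerZ hornerXn mulrCA [RHS]mulrCA; congr (_ * _).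
  have -> : n.+1 = (2 + (n.-1 - i) + i)%N by case: i => i /= ilt; lia.
  by rewrite !exprD -!mulrA pow mulr1.
ring.
Qed.

Lemma cvg_at_right_id (x : R) : (fun t : R => t) @ x^'+ --> x.
Proof. by apply: cvg_at_right_filter; exact: cvg_id. Qed.

Lemma cvg_perturbation (V : normedModType R) (g : V -> V) (v : V) :
  {for v, continuous g} ->
  (fun p : V * R => p.1 + p.2 *: g p.1) @ filter_prod (nbhs v) (0 : R)^'+ --> v.
Proof.
move=> cg; rewrite -[X in _ --> X]addr0 -(scale0r (g v)).
apply: cvgD; first exact: cvg_fst.
apply: cvgZ.
  apply: (cvg_comp snd (fun t : R => t)); first exact: cvg_snd.
  exact: cvg_at_right_id.
apply: (cvg_comp fst g); first exact: cvg_fst.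
exact: cg.
Qed.

Lemma cvg_perturbation_slope (V : normedModType R) (a b : V -> R) (v : V) :
  {for v, continuous a} -> {for v, continuous b} ->
  (fun p : V * R => a p.1 + p.2 * b p.1) @ filter_prod (nbhs v) (0 : R)^'+ --> a v.
Proof.
move=> ca cb; rewrite -[X in _ --> X](_ : a v + 0 * b v = a v); last by ring.
apply: cvgD; first by apply: (cvg_comp fst a); [exact: cvg_fst|exact: ca].
apply: cvgM.
  apply: (cvg_comp snd (fun t : R => t)); first exact: cvg_snd.
  exact: cvg_at_right_id.
by apply: (cvg_comp fst b); [exact: cvg_fst|exact: cb].
Qed.

(** Near each v, jointly with small t, the moved point stays in K: because v is interior to K,
    because |v| < 1, or because v is a contact point and |v + t g|^2 = |v|^2 + t (2 v.g + t |g|^2)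
    decreases. Compactness makes t uniform. *)
Lemma perturbed_ball_sub n (K : set 'cV[R]_n) (g : 'cV[R]_n -> 'cV[R]_n) :
  continuous g -> euclidean_ball n `<=` K ->
  (forall v, nsq v = 1 -> ~ K° v -> dot v (g v) < 0) ->
  \forall t \near (0 : R)^'+, forall v, euclidean_ball n v -> K (v + t *: g v).
Proof.
move=> cg BK gC.
have /compact_near_coveringP cB := compact_ball n.
have cdot : continuous (fun v => 2 * dot v (g v)).
  have -> : (fun v => 2 * dot v (g v)) = (fun v => \sum_i 2 * (v i 0 * g v i 0 - 0)).
    apply/funext => v; rewrite /dot mxE mulr_sumr; apply: eq_bigr => i _.
    by rewrite mxE subr0.
  apply: continuous_sum => i; apply: (continuous_affine _ (fun v : 'cV[R]_n => v i 0 * g v i 0)).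
  apply: (continuous_mul _ (fun v : 'cV[R]_n => v i 0)); first exact: coord_continuous.
  move=> v; apply: (cvg_comp g (fun w : 'cV[R]_n => w i 0)); first exact: cg.
  exact: coord_continuous.
have cnsqg : continuous (fun v => nsq (g v)).
  by move=> v; apply: (cvg_comp g); [exact: cg|exact: continuous_nsq].
suff H : \forall t \near (0 : R)^'+,
    euclidean_ball n `<=` (fun v => euclidean_ball n v -> K (v + t *: g v)).
  by apply: filterS H => t H v vB; exact: H.
apply: cB => v vB.
have yv := cvg_perturbation _ g v (cg v).
have near_gt0 : \forall p \near filter_prod (nbhs v) (0 : R)^'+, 0 < p.2.
  exact: (cvg_snd (nbhs_right_gt 0)).
have [vK|vK] := pselect (K° v).
  have H : \forall p \near filter_prod (nbhs v) (0 : R)^'+, K (p.1 + p.2 *: g p.1).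
    exact: (yv _ vK).
  by move: near_gt0 H; apply: filterS2 => p _ Kp _.
have [v1|v1] := ltP (nsq v) 1.
  have H : \forall p \near filter_prod (nbhs v) (0 : R)^'+, nsq (p.1 + p.2 *: g p.1) < 1.
    apply: (cvgr_lt (nsq v)) => //.
    by apply: (cvg_comp _ (@nsq R n) yv); exact: continuous_nsq.
  by move: near_gt0 H; apply: filterS2 => p _ p1 _; apply: BK; exact: (ltW p1).
have {}v1 : nsq v = 1 by apply/eqP; rewrite eq_le v1 andbT.
have : \forall p \near filter_prod (nbhs v) (0 : R)^'+, 2 * dot p.1 (g p.1) + p.2 * nsq (g p.1) < 0.
  apply: (cvgr_lt (2 * dot v (g v))).
    exact: (cvg_perturbation_slope _ _ _ v (cdot v) (cnsqg v)).
  by rewrite pmulr_rlt0//; exact: gC.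
move: near_gt0; apply: filterS2 => p p0 pneg pB; apply: BK; rewrite ballE nsqD dotZr nsqZ.
by move: pB; rewrite ballE; nra.
Qed.

End Perturbation.

(** * Contact points or a separating direction *)

Section JohnNecessary.
Context {R : realType}.

Lemma double_sum_ord n : (2 * (\sum_(i < n) i.+1) = n * n.+1)%N.
Proof.
elim: n => [|n IH]; first by rewrite big_ord0.
by rewrite big_ord_recr /= mulnDr IH; lia.
Qed.

Lemma card_lower_triangle n :
  #|[pred p : 'I_n * 'I_n | (p.2 <= p.1)%N]| = (n * n.+1 %/ 2)%N.
Proof.
have -> : (n * n.+1 %/ 2 = \sum_(i < n) i.+1)%N by rewrite -double_sum_ord mulKn.
rewrite -sum1_card (eq_bigl (fun p : 'I_n * 'I_n => true && (p.2 <= p.1)%N))//.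
rewrite -(pair_big_dep xpredT (fun i j : 'I_n => (j <= i)%N) (fun _ _ => 1%N)) /=.
apply: eq_bigr => i _.
rewrite (eq_bigl (fun j : 'I_n => (j < i.+1)%N))//.
by rewrite (big_ord_narrow (ltn_ord i)) sum1_card card_ord.
Qed.

(** The right-hand matrix is invertible, while a sum of k rank-one matrices has rank at most k. *)
Lemma john_condition_ge (d : nat) (s : R) (K : set 'cV[R]_(d + 1)) k :
  0 < s -> john_condition s K k -> (d + 1 <= k)%N.
Proof.
move=> s0 [u [c [_ _ sumE _]]].
have rS : \rank (block_mx 1%:M 0 0 s%:M : 'M[R]_(d + 1)) = (d + 1)%N.
  apply: mxrank_unit; rewrite unitmxE det_ublock det1 mul1r det_scalar1.
  by rewrite unitfE gt_eqF.
rewrite -rS -sumE.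
have -> : \sum_i c i *: (u i *m (u i)^T) =
    (\matrix_(r, i) (c i * u i r 0)) *m (\matrix_(i, r) u i r 0).
  apply/matrixP => p q; rewrite summxE mxE; apply: eq_bigr => i _.
  by rewrite !mxE big_ord1 !mxE mulrA.
by apply: leq_trans (mxrankM_maxr _ _) _; exact: rank_leq_row.
Qed.

(** The lower triangle coordinatises symmetric matrices; the second summand adds the coordinates of
    R^d. *)
Definition john_index d : finType :=
  ({p : 'I_(d + 1) * 'I_(d + 1) | (p.2 <= p.1)%N} + 'I_d)%type.

Lemma card_john_index d :
  #|john_index d|.+1 = ((d + 1) * (d + 2) %/ 2 + d + 1)%N.
Proof.
rewrite card_sum card_ord card_sig card_lower_triangle.
have -> : (d + 1).+1 = (d + 2)%N by lia.
by rewrite [RHS]addn1.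
Qed.

Lemma delta_mulE m n p (i k : 'I_m) (j : 'I_n) (X : 'M[R]_(n, p)) q :
  (delta_mx k j *m X) i q = (i == k)%:R * X j q.
Proof.
rewrite mxE (bigD1 j)//= mxE eqxx andbT big1 ?addr0// => l /negPf lj.
by rewrite mxE lj andbF mul0r.
Qed.

Lemma dot_delta n (u : 'cV[R]_n) i j : dot u (delta_mx i j *m u) = u i 0 * u j 0.
Proof.
rewrite /dot mxE (bigD1 i)//= delta_mulE eqxx mul1r mxE big1 ?addr0// => k ki.
by rewrite delta_mulE (negPf ki) mul0r mulr0.
Qed.

Lemma mxtrace_delta_mul n (i j : 'I_n) (X : 'M[R]_n) :
  \tr (delta_mx i j *m X) = X j i.
Proof.
rewrite /mxtrace (bigD1 i)//= delta_mulE eqxx mul1r big1 ?addr0// => k ki.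
by rewrite delta_mulE (negPf ki) mul0r.
Qed.

Lemma dot_col_mx m n (x z : 'cV[R]_m) (y w : 'cV[R]_n) :
  dot (col_mx x y) (col_mx z w) = dot x z + dot y w.
Proof. by rewrite /dot tr_col_mx mul_row_col mxE. Qed.

Lemma dot_tr_mul n (M : 'M[R]_n) (x : 'cV[R]_n) : dot x (M^T *m x) = dot x (M *m x).
Proof. by rewrite [RHS]dotC /dot trmx_mul mulmxA. Qed.

(** The middle term is odd in [xi], so it cancels when a contact point is averaged with its mirror
    image. *)
Lemma dot_lift_block d (W : 'M[R]_(d + 1)) (x : 'cV[R]_d) xi :
  dot (lift_pt x xi) (W *m lift_pt x xi) =
  dot x (ulsubmx W *m x) + xi * (dot x (ursubmx W) + (dlsubmx W *m x) 0 0)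
  + drsubmx W 0 0 * xi ^+ 2.
Proof.
rewrite -[W in LHS]submxK /lift_pt mul_block_col dot_col_mx dotDr.
rewrite !mul_mx_scalar dotZr [X in _ + X = _]mxE big_ord1.
by rewrite !mxE eqxx !mulr1n; ring.
Qed.

Lemma interior_reflect d (K : set 'cV[R]_(d + 1)) x xi :
  d_symmetric K -> K° (lift_pt x xi) -> K° (lift_pt x (- xi)).
Proof.
move=> Ks; pose rho (v : 'cV[R]_(d + 1)) := block_mx 1%:M 0 0 (- 1%:M) *m v.
have rhoE y w : rho (lift_pt y w) = lift_pt y (- w).
  rewrite /rho /lift_pt mul_block_col mul1mx !mul0mx addr0 add0r mulNmx mul1mx.
  by rewrite raddfN.
have crho : continuous rho by exact: continuous_mulmxr.
move=> Kx; have : (K \o rho)° (lift_pt x (- xi)).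
  by apply: (crho _); rewrite rhoE opprK.
rewrite /interior; apply: filterS => v /=.
by rewrite -[v]lift_ptK rhoE => /Ks; rewrite opprK.
Qed.

Section Alternative.
Variables (d : nat) (s : R) (K : set 'cV[R]_(d + 1)).
Hypotheses (s_gt0 : 0 < s) (K_sym : d_symmetric K)
  (ball_sub_K : euclidean_ball (d + 1) `<=` K).

Let target : 'M[R]_(d + 1) := block_mx 1%:M 0 0 s%:M.
(** Unit vectors lie in [K], so for them avoiding the interior means being on the boundary; in this
    form the set is visibly closed. *)
Let contact := [set u : 'cV[R]_(d + 1) | nsq u = 1] `&` ~` K°.

(* Coordinates of [(u u^T - S / tr S, u)] in the space of symmetric matrices
   times [R^d]. *)
Let coords (u : 'cV[R]_(d + 1)) (y : john_index d) : R :=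
  match y with
  | inl p => u (val p).1 0 * u (val p).2 0 - target (val p).1 (val p).2 / (d%:R + s)
  | inr i => u (lshift 1 i) 0
  end.

Let trS_gt0 : 0 < d%:R + s.
Proof. by rewrite ltr_wpDl. Qed.

Let compact_contact : compact contact.
Proof.
apply: subclosed_compact (compact_ball (d + 1)) _; last first.
  by move=> u [u1 _]; rewrite ballE u1.
apply: closedI; last exact/open_closedC/open_interior.
apply: (@closed_comp _ _ (@nsq R (d + 1)) [set 1]); last exact: closed_eq.
by move=> v _; exact: continuous_nsq.
Qed.

Let continuous_coords y : continuous (fun u => coords u y).
Proof.
case: y => [p|i] /=; last exact: coord_continuous.
under eq_fun do rewrite -[X in X - _]mul1r -[X in _ - X]mul1r -mulrBr.
apply: (continuous_affine _ (fun u : 'cV[R]_(d + 1) => u (val p).1 0 * u (val p).2 0)).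
apply: (continuous_mul _ (fun u : 'cV[R]_(d + 1) => u (val p).1 0));
  exact: coord_continuous.
Qed.

Let target_sym p q : target p q = target q p.
Proof.
have : target^T = target by rewrite tr_block_mx !trmx0 trmx1 tr_scalar_mx.
by move=> /matrixP/(_ p q); rewrite mxE.
Qed.

Lemma john_or_separation :
  (exists k, (d + 1 <= k <= (d + 1) * (d + 2) %/ 2 + d + 1)%N /\
     john_condition s K k) \/
  (exists (H : 'M[R]_d) (eta : R) (h : 'cV[R]_d),
    [/\ H^T = H, 0 < \tr H + s * eta &
      forall x xi, nsq x + xi ^+ 2 = 1 -> ~ K° (lift_pt x xi) ->
        dot x (H *m x) + eta * xi ^+ 2 + dot h x < 0]).
Proof.
have [[u [l [uC l0 sl lE]]]|[w [e [e0 wC]]]] :=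
  convex_combination_or_separation _ _ _ coords compact_contact continuous_coords.
  (* Zero weights are discarded, since (J) asks for positive ones, and the rest are rescaled by tr S
     = d + s. *)
  left; pose A := [pred i | 0 < l i].
  have sumA (V : lmodType R) (F : _ -> V) :
      \sum_(j < #|A|) ((d%:R + s) * l (enum_val j)) *: F (enum_val j) =
      (d%:R + s) *: \sum_i l i *: F i.
    rewrite -(big_enum_val (fun i => ((d%:R + s) * l i) *: F i)) scaler_sumr.
    rewrite big_mkcond /=; apply: eq_bigr => i _; case: ifPn; rewrite scalerA//.
    rewrite inE /= -leNgt => li; have -> : l i = 0 by apply/eqP; rewrite eq_le li l0.
    by rewrite mulr0 scale0r.
  have J : john_condition s K #|A|.
    exists (fun j => u (enum_val j)), (fun j => (d%:R + s) * l (enum_val j)); split.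
    - move=> j; have [u1 uK] := uC (enum_val j); split; first exact/bd_ball.
      split=> //; apply: subset_closure; apply: ball_sub_K.
      by rewrite ballE u1.
    - by move=> j; rewrite mulr_gt0//; have := enum_valP j.
    - rewrite (sumA _ (fun i => u i *m (u i)^T)).
      have lt (p q : 'I_(d + 1)) : (q <= p)%N ->
          (d%:R + s) * (\sum_i l i * (u i p 0 * u i q 0)) = target p q.
        move=> qp; have := lE (inl (exist _ (p, q) qp)); rewrite /coords /=.
        under eq_bigr do rewrite mulrBr.
        rewrite big_split /= sumrN -mulr_suml sl mul1r => /eqP.
        by rewrite subr_eq0 => /eqP ->; rewrite mulrC divfK// gt_eqF.
      apply/matrixP => p q; rewrite mxE summxE -/target.
      have E : \sum_i (l i *: (u i *m (u i)^T)) p q = \sum_i l i * (u i p 0 * u i q 0).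
        by apply: eq_bigr => i _; rewrite !mxE big_ord1 !mxE.
      rewrite E; have [qp|pq] := leqP q p; first exact: lt.
      rewrite target_sym -(lt _ _ (ltnW pq)); congr (_ * _).
      by apply: eq_bigr => i _; rewrite [u i p 0 * _]mulrC.
    - rewrite (sumA _ (fun i => usubmx (u i))).
      have -> : \sum_i l i *: usubmx (u i) = 0; last by rewrite scaler0.
      apply/colP => r; rewrite summxE [RHS]mxE -[RHS](lE (inr r)).
      by apply: eq_bigr => i _; rewrite !mxE.
  exists #|A|; split=> //; rewrite (john_condition_ge _ _ _ _ s_gt0 J) /=.
  by rewrite -card_john_index; apply: leq_trans (max_card _) _; rewrite card_ord.
right.
pose W : 'M[R]_(d + 1) := \sum_p w (inl p) *: delta_mx (val p).1 (val p).2.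
pose hw : 'cV[R]_d := \col_i w (inr i).
pose m := \tr (W *m target) / (d%:R + s).
have trW : \tr (W *m target) = \tr (ulsubmx W) + s * drsubmx W 0 0.
  rewrite -[W]submxK mulmx_block !(mulmx0, mul0mx, mulmx1, addr0, add0r).
  rewrite mxtrace_block block_mxKul block_mxKdr; congr (_ + _).
  by rewrite mul_mx_scalar mxtraceZ {1}[drsubmx W]mx11_scalar mxtrace_scalar.
have wE u : \sum_y w y * coords u y = dot u (W *m u) + dot hw (usubmx u) - m.
  rewrite big_sumType /= addrAC; congr (_ + _); last first.
    by rewrite /dot mxE; apply: eq_bigr => i _; rewrite !mxE.
  have -> : dot u (W *m u) = \sum_p w (inl p) * (u (val p).1 0 * u (val p).2 0).
    rewrite /W mulmx_suml; under eq_bigr do rewrite -scalemxAl.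
    rewrite /dot mulmx_sumr summxE; apply: eq_bigr => p _.
    by rewrite -scalemxAr mxE -dot_delta.
  have -> : m = \sum_p w (inl p) * (target (val p).1 (val p).2 / (d%:R + s)).
    rewrite /m /W mulmx_suml (raddf_sum (@mxtrace R _)) mulr_suml.
    apply: eq_bigr => p _ /=.
    by rewrite -scalemxAl mxtraceZ mxtrace_delta_mul target_sym mulrA.
  by rewrite -sumrB; apply: eq_bigr => p _; rewrite mulrBr.
(* The threshold [t] halves the margin [e]: tr H + s eta becomes (e/2)(d + s), and the form at a
   contact point is at most t - (e + m) = -e/2. *)
pose A1 := ulsubmx W; pose om := drsubmx W 0 0; pose t := m + e / 2.
have key x xi : nsq x + xi ^+ 2 = 1 -> ~ K° (lift_pt x xi) ->
    e + m <= dot x (A1 *m x) + om * xi ^+ 2 + dot hw x.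
  move=> x1 xK; have Cu : contact (lift_pt x xi) by split=> //=; rewrite nsq_lift.
  have Cu' : contact (lift_pt x (- xi)).
    split; first by rewrite /= nsq_lift sqrrN.
    by move=> /(interior_reflect _ _ _ _ K_sym); rewrite opprK.
  have := wC _ Cu; have := wC _ Cu'; rewrite !wE !dot_lift_block sqrrN /lift_pt !col_mxKu.
  by rewrite -/A1 -/om; lra.
(* [W] is built from lower-triangle coefficients, so its block must be symmetrised, which changes
   neither the trace nor the quadratic form. *)
exists (t%:M - 2^-1 *: (A1 + A1^T)), (t - om), (- hw); split.
- by apply/matrixP => i j; rewrite !mxE [j == i]eq_sym; ring.
- rewrite raddfB/= mxtrace_scalar mxtraceZ mxtraceD mxtrace_tr.
  have mE : m * (d%:R + s) = \tr A1 + s * om by rewrite -trW /m divfK ?gt_eqF.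
  have -> : t *+ d - 2^-1 * (\tr A1 + \tr A1) + s * (t - om) =
      t * (d%:R + s) - (\tr A1 + s * om) by rewrite -mulr_natr; field.
  by rewrite -mE -mulrBl mulr_gt0// /t; lra.
- move=> x xi x1 xK; have := key x xi x1 xK.
  have -> : dot x ((t%:M - 2^-1 *: (A1 + A1^T)) *m x) = t * nsq x - dot x (A1 *m x).
    rewrite mulmxBl mul_scalar_mx -scaleN1r -!scalemxAl mulmxDl dotDr !dotZr dotDr.
    by rewrite dot_tr_mul dotvv; field.
  have -> : dot (- hw) x = - dot hw x by rewrite dotC -scaleN1r dotZr mulN1r dotC.
  have -> : nsq x = 1 - xi ^+ 2 by rewrite -x1 addrK.
  by rewrite /t; lra.
Qed.

End Alternative.
End JohnNecessary.

(** * Separation contradicts local maximality *)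

Section LocalMaximum.
Context {R : realType}.

Lemma cvg_line (V : normedModType R) (a b : V) :
  (fun t : R => a + t *: b) @ (0 : R)^'+ --> a.
Proof.
rewrite -[X in _ --> X]addr0 -[X in _ + X](scale0r b).
by apply: cvgD; [exact: cvg_cst|apply: cvgZr_tmp; exact: cvg_at_right_id].
Qed.

Lemma cvg_line_pair (V W : normedModType R) (a b : V) (c e : W) :
  (fun t : R => (a + t *: b, c + t *: e)) @ (0 : R)^'+ --> (a, c).
Proof. by apply: cvg_pair; exact: cvg_line. Qed.

Lemma continuous_translate (T : topologicalType) (V : normedModType R) (f : T -> V) (a : V) :
  continuous f -> continuous (fun x => f x + a).
Proof. by move=> cf x; apply: cvgD; [exact: cf|exact: cvg_cst]. Qed.

Lemma ln_ge_1Binv (x : R) : 0 < x -> 1 - x^-1 <= ln x.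
Proof.
move=> x0; have := ln_le_subr1 x^-1; rewrite invr_gt0 lnV ?posrE// => /(_ x0).
by lra.
Qed.

Lemma posdef_add1_scale n (H : 'M[R]_n) t : H^T = H -> 0 <= t ->
  t * (\sum_i \sum_j `|H i j|) < 1 -> posdef (1%:M + t *: H).
Proof.
move=> Hs t0 tH; split; first by rewrite linearD/= linearZ/= trmx1 Hs.
move=> x x0; rewrite -mulmxA -/(dot x _) mulmxDl mul1mx -scalemxAl dotDr dotZr dotvv.
have nx : 0 < nsq x.
  by rewrite lt0r nsq_ge0 andbT; apply: contraNneq x0 => /nsq_eq0 ->.
have := dot_mulmx_le n H x; rewrite ler_norml => /andP[Hx _].
have : t * (- ((\sum_i \sum_j `|H i j|) * nsq x)) <= t * dot x (H *m x).
  by rewrite ler_wpM2l.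
have : 0 < (1 - t * (\sum_i \sum_j `|H i j|)) * nsq x by rewrite mulr_gt0 ?subr_gt0.
by lra.
Qed.

Lemma mul_fin_leP (D : R) (I : \bar R) : (0 < I < +oo)%E ->
  (D%:E * I <= I)%E = (D <= 1).
Proof.
case: I => [i| |]//=; last by rewrite ltxx andbF.
by rewrite lte_fin => /andP[i0 _]; rewrite -EFinM lee_fin ger_pMl.
Qed.

Lemma mul_fin_geP (D : R) (I : \bar R) : (0 < I < +oo)%E ->
  (I <= D%:E * I)%E = (1 <= D).
Proof.
case: I => [i| |]//=; last by rewrite ltxx andbF.
by rewrite lte_fin => /andP[i0 _]; rewrite -EFinM lee_fin ler_pMl.
Qed.

(** The map v -> v + t g(v) carries the ball onto the ellipsoid [p t], which lies in [K] and near
    the ball for small t > 0. A positive trace condition would make its s-volume strictly larger. *)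
Lemma local_max_no_separation (d : nat) (s : R) (K : set 'cV[R]_(d + 1))
    (H : 'M[R]_d) (eta : R) (h : 'cV[R]_d) :
  0 < s -> locally_max_ball s K -> H^T = H ->
  (forall x xi, nsq x + xi ^+ 2 = 1 -> ~ K° (lift_pt x xi) ->
     dot x (H *m x) + eta * xi ^+ 2 + dot h x < 0) ->
  \tr H + s * eta <= 0.
Proof.
move=> s0 [BK locmax] Hs sep; rewrite leNgt; apply/negP => trH0.
pose Hb : 'M[R]_(d + 1) := block_mx H 0 0 eta%:M.
pose g (v : 'cV[R]_(d + 1)) := Hb *m v + lift_pt h 0.
have cg : continuous g.
  by apply: continuous_translate; exact: continuous_mulmxr.
have gneg v : nsq v = 1 -> ~ K° v -> dot v (g v) < 0.
  rewrite -[v]lift_ptK nsq_lift; set x := usubmx v; set xi := dsubmx v 0 0 => v1 vK.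
  rewrite /g dotDr dot_lift_block /Hb block_mxKul block_mxKur block_mxKdl block_mxKdr.
  rewrite /lift_pt dot_col_mx mul0mx.
  have -> : dot x (0 : 'cV_d) = 0 by rewrite /dot mulmx0 mxE.
  have -> : dot (xi%:M : 'cV_1) (0%:M : 'cV_1) = 0 by rewrite /dot raddf0 mulmx0 mxE.
  rewrite [(0 : 'cV_1) _ _]mxE [eta%:M _ _]mxE eqxx mulr1n (dotC _ x h).
  by have := sep x xi v1 vK; lra.
have [r detE] := det_add1_scale d H.
(* With D the determinant and al = 1 + t eta, the bound 1 - 1/x <= ln x gives ln D + s ln al >= t
   q(t) / (D al); at t = 0 the polynomial equals tr H + s eta. *)
pose q : {poly R} := ((\tr H)%:P + 'X * r) * (1 + eta%:P * 'X) +
  (s * eta)%:P * (1 + (\tr H)%:P * 'X + 'X ^+ 2 * r).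
have q0 : 0 < q.[0] by rewrite /q !hornerE /=; move: trH0; lra.
pose p (t : R) : 'M[R]_(d + 1) * 'cV[R]_d := (1%:M + t *: Hb, 0 + t *: h).
have cp : p @ (0 : R)^'+ --> ((1%:M : 'M[R]_(d + 1)), (0 : 'cV[R]_d)).
  exact: cvg_line_pair.
have Hnear : \forall t \near (0 : R)^'+, t * (\sum_i \sum_j `|H i j|) < 1.
  have C := cubic_gt0_near 1 (- \sum_i \sum_j `|H i j|) 0 0 ltr01.
  by apply: (filterS _ C) => t; rewrite !mul0r !addr0 mulNr subr_gt0 mulrC.
have eta_near : \forall t \near (0 : R)^'+, 0 < 1 + t * eta.
  have C := cubic_gt0_near 1 eta 0 0 ltr01.
  by apply: (filterS _ C) => t; rewrite !mul0r !addr0 mulrC.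
near (0 : R)^'+ => t.
have t0 : 0 < t by near: t; exact: nbhs_right_gt.
have tH : t * (\sum_i \sum_j `|H i j|) < 1.
  near: t; exact: Hnear.
have al0 : 0 < 1 + t * eta.
  near: t; exact: eta_near.
have qt : 0 < q.[t].
  near: t; apply: (cvgr_gt _ (cvg_at_right_filter _) _ q0).
  exact: continuous_horner.
have EK : forall v, euclidean_ball (d + 1) v -> K (v + t *: g v).
  by near: t; exact: perturbed_ball_sub.
have lm : ellipsoid_pair (p t) -> ellipsoid (p t) `<=` K ->
    (s_volume s (ellipsoid (p t)) <= s_volume s (euclidean_ball (d + 1)))%E.
  by near: t; exact: (cp _ locmax).
have pA := posdef_add1_scale _ _ _ Hs (ltW t0) tH.
have pE : p t = (block_mx (1%:M + t *: H) 0 0 (1 + t * eta)%:M, t *: h).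
  rewrite /p add0r; congr pair; rewrite (scalar_mx_block d 1) scale_block_mx.
  by rewrite add_block_mx !scaler0 !addr0 raddfD/= scale_scalar_mx.
have /lm : ellipsoid_pair (p t).
  by exists (1%:M + t *: H), (1 + t * eta); split=> //; rewrite pE.
have sub : ellipsoid (p t) `<=` K.
  move=> _ [v vb <-]; have := EK v vb; congr K; rewrite /g /p /=.
  rewrite scalerDr mulmxDl mul1mx -scalemxAl addrA add0r; congr (_ + _).
  by rewrite /lift_pt scale_col_mx scale_scalar_mx mulr0.
move=> /(_ sub); rewrite pE s_volume_ellipsoid// s_volume_ball//.
rewrite mul_fin_leP ?ball_profile_integral_bounds// leNgt => /negP; apply.
have D0 := posdef_det_gt0 _ _ pA; have as0 := powR_gt0 s al0.
have DE := detE t (lt0r_neq0 t0).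
rewrite -ltr_ln ?posrE ?mulr_gt0// ln1 lnM ?posrE// ln_powR.
have L1 := ln_ge_1Binv _ D0.
have L2 : s * (1 - (1 + t * eta)^-1) <= s * ln (1 + t * eta).
  by rewrite ler_pM2l//; exact: ln_ge_1Binv.
apply: lt_le_trans (lerD L1 L2).
set D := \det _ in D0 DE *; set al := 1 + t * eta in al0 *.
have -> : 1 - D^-1 + s * (1 - al^-1) = t * q.[t] / (D * al).
  have -> : q.[t] = (\tr H + t * r.[t]) * al + (s * eta) * D.
    by rewrite /q !hornerE /= DE /al; ring.
  have -> : \tr H + t * r.[t] = (D - 1) / t.
    by rewrite DE; field; exact: lt0r_neq0.
  have -> : eta = (al - 1) / t by rewrite /al; field; exact: lt0r_neq0.
  by clearbody al; field; rewrite !lt0r_neq0.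
by rewrite divr_gt0 ?mulr_gt0.
Unshelve. all: by end_near. Qed.

End LocalMaximum.

Theorem theorem5p1 (R : realType) (d : nat) (s : R) (K : set 'cV[R]_(d + 1))
    (s_gt0 : 0 < s)
    (K_closed : closed K) (K_sym : d_symmetric K)
    (ball_sub_K : euclidean_ball (d + 1) `<=` K) :
  (locally_max_ball s K ->
     (exists k, john_condition s K k) /\
     (exists k, (d + 1 <= k <= ((d + 1) * (d + 2)) %/ 2 + d + 1)%N /\
                john_condition s K k)) /\
  (forall f : 'cV[R]_d -> R,
     proper_log_concave f -> K = s_lifting s f ->
     (exists k, john_condition s K k) ->
     max_ellipsoid s K (euclidean_ball (d + 1)) /\
     (forall E, max_ellipsoid s K E -> E = euclidean_ball (d + 1))).
Proof.
split=> [locmax|f [lcf _ _] KE [k J]].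
  have [[k [kd J]]|[H [eta [h [Hs trH sep]]]]] :=
    john_or_separation d s K s_gt0 K_sym ball_sub_K.
    by split; exists k.
  have := local_max_no_separation d s K H eta h s_gt0 locmax Hs sep.
  by rewrite leNgt trH.
have bounds := ball_profile_integral_bounds s d 1 s_gt0 ltr01.
have pair1 : ellipsoid_pair ((1%:M : 'M[R]_(d + 1)), (0 : 'cV[R]_d)).
  exists 1%:M, 1; split; [exact: posdef1|exact: ltr01|exact: (scalar_mx_block d 1)].
(* Writing the volume ratio as an exponential reduces comparison with the ball to the sign of ln det
   A + s ln alpha. *)
have volE (A : 'M[R]_d) alpha a : posdef A -> 0 < alpha ->
    s_volume s (ellipsoid (block_mx A 0 0 alpha%:M, a)) =
    ((expR (ln (\det A) + s * ln alpha))%:E * s_volume s (euclidean_ball (d + 1)))%E.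
  move=> pA al0; rewrite s_volume_ellipsoid// s_volume_ball//.
  rewrite expRD lnK ?posrE ?posdef_det_gt0//.
  by rewrite -ln_powR lnK// posrE powR_gt0.
have {}bounds : (0 < s_volume s (euclidean_ball (d + 1)) < +oo)%E.
  by rewrite s_volume_ball.
have volle (A : 'M[R]_d) alpha a : posdef A -> 0 < alpha ->
    ellipsoid (block_mx A 0 0 alpha%:M, a) `<=` K ->
    ln (\det A) + s * ln alpha <= 0 /\
    (0 <= ln (\det A) + s * ln alpha -> [/\ A = 1%:M, alpha = 1 & a = 0]).
  rewrite KE in ball_sub_K J *; exact: john_volume_le s_gt0 lcf ball_sub_K J.
split.
  split=> // [|[p1 p2] [A [alpha [pA al0 /= ->]]] EK].
    by exists ((1%:M : 'M[R]_(d + 1)), (0 : 'cV[R]_d)); rewrite ?ellipsoid1.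
  have [H _] := volle _ _ _ pA al0 EK.
  by rewrite volE// mul_fin_leP// -expR0 ler_expR.
move=> E [[[p1 p2] [A [alpha [pA al0 /= p1E]]] EE] EK Emax].
rewrite p1E in EE; rewrite EE in EK Emax *.
have [_ H] := volle _ _ _ pA al0 EK.
(* The ball competes with any other maximiser, which forces the logarithmic ratio to be nonnegative
   and hence the equality case. *)
have := Emax _ pair1; rewrite ellipsoid1 => /(_ ball_sub_K).
rewrite volE// mul_fin_geP// -[X in X <= _]expR0 ler_expR => /H[-> -> ->].
by rewrite -(scalar_mx_block d 1) ellipsoid1.
Qed.
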